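(* Let $k$ be a field and let $f:X\to Y$ be a morphism of Noetherian $k$-schemes. Then $f$ is formally étale if and only if the naturality square $$\begin{array}{ccc} X & \longrightarrow & \Im X\\ {\scriptstyle f}\downarrow & & \downarrow{\scriptstyle \Im f}\\ Y & \longrightarrow & \Im Y\end{array}$$ is a pullback square in the category $\mathrm{Psh}(k\text{-}\mathrm{Alg}_{\mathrm{fg}}^{\mathrm{op}})$.
   Context: All rings and algebras are commutative with unit. $k\text{-}\mathrm{Alg}_{\mathrm{fg}}$ is the category of finitely generated $k$-algebras, and $\mathrm{Psh}(k\text{-}\mathrm{Alg}_{\mathrm{fg}}^{\mathrm{op}})$ is the category of functors from $k\text{-}\mathrm{Alg}_{\mathrm{fg}}$ to sets. Affine Noetherian $k$-schemes are the representable functors $\mathrm{Spec}(A)=k\text{-}\mathrm{Alg}_{\mathrm{fg}}(A,-)$ with $A\in k\text{-}\mathrm{Alg}_{\mathrm{fg}}$; these are the basic building blocks of Noetherian $k$-schemes (so a Noetherian $k$-scheme is a Noetherian scheme over $k$ covered by such affine schemes), and Noetherian $k$-schemes are regarded as objects of $\mathrm{Psh}(k\text{-}\mathrm{Alg}_{\mathrm{fg}}^{\mathrm{op}})$ through their functors of points. The endofunctor $\Im$ of $\mathrm{Psh}(k\text{-}\mathrm{Alg}_{\mathrm{fg}}^{\mathrm{op}})$ is defined by $(\Im X)(A):=X(A/\sqrt 0)$, where $\sqrt 0$ is the nilradical of $A$; the natural map $X\to\Im X$ is given at $A$ by $X$ applied to the quotient map $A\to A/\sqrt 0$. A morphism of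 schemes $f:X\to Y$ is formally étale if for all rings $R$ and all nilpotent ideals $N\subseteq R$, every commutative square with left side $\mathrm{Spec}(R/N)\to\mathrm{Spec}(R)$ and right side $f:X\to Y$ has a unique diagonal lift $\mathrm{Spec}(R)\to X$ making both triangles commute. *)

(* Defs.v *)
From HB Require Import structures.
From mathcomp Require Import all_boot all_algebra.
From mathcomp Require Import boolp classical_sets.

Set Implicit Arguments.
Unset Strict Implicit.
Unset Printing Implicit Defensive.

Import GRing.Theory.
Local Open Scope classical_set_scope.
Local Open Scope ring_scope.
Local Open Scope quotient_scope.

#[local] Obligation Tactic := idtac.

(* Schemes are treated through their functors of points, in the style of      *)
(* Demazure-Gabriel, Groupes algebriques, I.1: a scheme is a functor from     *)
(* commutative rings to sets that is a Zariski sheaf and is covered by open   *)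
(* affine subfunctors.  Rings are comPzRingType throughout, because the zero  *)
(* ring (the empty affine scheme) must be allowed.                            *)

Record category := Category {
  obj :> Type;
  arr : obj -> obj -> Type;
  arr_id : forall a, arr a a;
  arr_comp : forall a b c, arr b c -> arr a b -> arr a c;
  comp1m : forall a b (f : arr a b), arr_comp (arr_id b) f = f;
  compm1 : forall a b (f : arr a b), arr_comp f (arr_id a) = f;
  compA : forall a b c d (h : arr c d) (g : arr b c) (f : arr a b),
    arr_comp h (arr_comp g f) = arr_comp (arr_comp h g) f
}.

Arguments arr {_} _ _.
Arguments arr_id {_} _.
Arguments arr_comp {_ _ _ _} _ _.

Record setfunctor (C : category) := SetFunctor {
  fobj :> C -> Type;
  fmap : forall a b : C, arr a b -> fobj a -> fobj b;
  fmap1 : forall (a : C) (x : fobj a), fmap (arr_id a) x = x;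
  fmapM : forall (a b c : C) (g : arr b c) (f : arr a b) (x : fobj a),
    fmap (arr_comp g f) x = fmap g (fmap f x)
}.

Arguments fmap {_} _ {_ _} _ _.

Record nattrans (C : category) (F G : setfunctor C) := NatTrans {
  ncomp :> forall a : C, F a -> G a;
  nat_natural : forall (a b : C) (f : arr a b) (x : F a),
    ncomp (fmap F f x) = fmap G f (ncomp x)
}.

Arguments ncomp {_ _ _} _ _ _.

Lemma nattrans_eq (C : category) (F G : setfunctor C) (u v : nattrans F G) :
  (forall a x, u a x = v a x) -> u = v.
Proof.
case: u v => u Hu [v Hv] /= uv.
have e : u = v by apply: functional_extensionality_dep => a; apply: funext => x.
by case: v / e Hv {uv} => Hv; congr NatTrans; apply: Prop_irrelevance.
Qed.

Program Definition nat_comp (C : category) (F G H : setfunctor C)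
    (v : nattrans G H) (u : nattrans F G) : nattrans F H :=
  {| ncomp := fun a x => v a (u a x) |}.
Next Obligation. by move=> C F G H v u a b f x; rewrite /= !nat_natural. Qed.

(* The functor arr(a, -); over commutative rings this is Spec a. *)
Program Definition corep (C : category) (a : C) : setfunctor C :=
  {| fobj := fun b => arr a b; fmap := fun b c f g => arr_comp f g |}.
Next Obligation. by move=> C a b x; apply: comp1m. Qed.
Next Obligation. by move=> C a b c d g f x; rewrite /= compA. Qed.

Program Definition corep_map (C : category) (a b : C) (f : arr a b) :
    nattrans (corep b) (corep a) :=
  {| ncomp := fun c g => arr_comp g f |}.
Next Obligation. by move=> C a b f c d g h /=; rewrite compA. Qed.

(* The square                                                                 *)
(*    P --q--> B                                                              *)
(*    |p       |b                                                             *)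
(*    A --a--> D                                                              *)
(* is a pullback in the category of set-valued functors on C.                 *)
Definition is_pullback (C : category) (P A B D : setfunctor C)
    (p : nattrans P A) (q : nattrans P B)
    (a : nattrans A D) (b : nattrans B D) : Prop :=
  nat_comp a p = nat_comp b q /\
  forall (Z : setfunctor C) (u : nattrans Z A) (v : nattrans Z B),
    nat_comp a u = nat_comp b v ->
    exists! w : nattrans Z P, nat_comp p w = u /\ nat_comp q w = v.

Lemma rmorphism_eq (R S : comPzRingType) (f g : {rmorphism R -> S}) :
  f =1 g -> f = g.
Proof.
case: f g => f Hf [g Hg] /= /funext e.
case: g / e Hg => Hg; congr GRing.RMorphism.Pack.
case: Hf Hg => [[a] [b]] [[c] [d]].
by rewrite (Prop_irrelevance a c) (Prop_irrelevance b d).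
Qed.

Definition rid (R : comPzRingType) : {rmorphism R -> R} := idfun.
Definition rcomp (R S T : comPzRingType) (g : {rmorphism S -> T})
  (f : {rmorphism R -> S}) : {rmorphism R -> T} := g \o f.

Program Definition CRing : category :=
  {| obj := comPzRingType;
     arr := fun R S => {rmorphism R -> S};
     arr_id := rid;
     arr_comp := rcomp |}.
Next Obligation. by move=> R S f; apply: rmorphism_eq. Qed.
Next Obligation. by move=> R S f; apply: rmorphism_eq. Qed.
Next Obligation. by move=> R S T U h g f; apply: rmorphism_eq. Qed.

Definition is_ideal (R : comPzRingType) (I : set R) : Prop :=
  [/\ I 0, forall x y, I x -> I y -> I (x + y) & forall a x, I x -> I (a * x)].

Record ideal (R : comPzRingType) := Ideal {
  ideal_set :> R -> Prop;
  idealP : is_ideal ideal_set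
}.

Definition ideal_gen (R : comPzRingType) (E : set R) : set R :=
  [set x | forall J : ideal R, E `<=` J -> J x].

Definition unit_ideal (R : comPzRingType) (E : set R) : Prop := ideal_gen E 1.

Definition noetherian_ring (R : comPzRingType) : Prop :=
  forall I : ideal R,
    exists s : seq R, ideal_set I = ideal_gen [set x | x \in s].

(* I ^ n = 0 for some n: the ideal I ^ n is generated by the products of n    *)
(* elements of I.                                                             *)
Definition nilpotent_ideal (R : comPzRingType) (I : ideal R) : Prop :=
  exists n : nat,
    forall a : 'I_n -> R, (forall i, I (a i)) -> \prod_(i < n) a i = 0.

Section IdealTheory.
Variables (R : comPzRingType) (I : ideal R).

Lemma ideal0 : I 0. Proof. by case: (idealP I). Qed.
Lemma idealD x y : I x -> I y -> I (x + y).
Proof. by case: (idealP I) => _ + _; apply. Qed.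
Lemma idealMl a x : I x -> I (a * x).
Proof. by case: (idealP I) => _ _; apply. Qed.
Lemma idealN x : I x -> I (- x).
Proof. by move=> Ix; rewrite -mulN1r; apply: idealMl. Qed.

End IdealTheory.

(* The quotients of ring_quotient.v are restricted to proper ideals of        *)
(* nonzero rings, hence the construction below.                               *)
Section Quotient.
Variables (R : comPzRingType) (I : ideal R).

Definition qequiv (x y : R) : bool := `[< I (x - y) >].

Lemma qequiv_refl : reflexive qequiv.
Proof. by move=> x; apply/asboolP; rewrite subrr; apply: ideal0. Qed.
Lemma qequiv_sym : symmetric qequiv.
Proof.
by move=> x y; apply/asboolP/asboolP => h; rewrite -opprB; apply: idealN.
Qed.
Lemma qequiv_trans : transitive qequiv.
Proof.
move=> y x z /asboolP h1 /asboolP h2; apply/asboolP.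
by rewrite -(subrK y x) -addrA; apply: idealD.
Qed.

Canonical qequiv_rel := EquivRel qequiv qequiv_refl qequiv_sym qequiv_trans.

Definition quot : Type := {eq_quot qequiv}.
HB.instance Definition _ : EqQuotient R qequiv quot := EqQuotient.on quot.
HB.instance Definition _ := Choice.on quot.

Lemma qpi_eq (x y : R) : (\pi_quot x = \pi_quot y) <-> I (x - y).
Proof.
split=> [/eqP|h]; first by rewrite piE => /asboolP.
by apply/eqP; rewrite piE; apply/asboolP.
Qed.

Lemma qrepr (x : R) : I (repr (\pi_quot x) - x).
Proof. by apply/qpi_eq; rewrite reprK. Qed.

Definition qadd (u v : quot) : quot := \pi_quot (repr u + repr v).
Definition qopp (u : quot) : quot := \pi_quot (- repr u).
Definition qmul (u v : quot) : quot := \pi_quot (repr u * repr v).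

Lemma qaddE x y : qadd (\pi_quot x) (\pi_quot y) = \pi_quot (x + y).
Proof.
apply/qpi_eq; rewrite opprD addrACA.
by apply: idealD; apply: qrepr.
Qed.
Lemma qoppE x : qopp (\pi_quot x) = \pi_quot (- x).
Proof. by apply/qpi_eq; rewrite -opprD; apply/idealN/qrepr. Qed.
Lemma qmulE x y : qmul (\pi_quot x) (\pi_quot y) = \pi_quot (x * y).
Proof.
apply/qpi_eq; set x' := repr _; set y' := repr _.
have -> : x' * y' - x * y = x' * (y' - y) + y * (x' - x).
  by rewrite !mulrBr (mulrC y x') (mulrC y x) addrA subrK.
by apply: idealD; apply: idealMl; apply: qrepr.
Qed.

Lemma qaddA : associative qadd.
Proof.
elim/quotW=> x; elim/quotW=> y; elim/quotW=> z.
by rewrite (qaddE y z) (qaddE x y) !qaddE addrA.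
Qed.
Lemma qaddC : commutative qadd.
Proof. by move=> u v; rewrite -(reprK u) -(reprK v) !qaddE addrC. Qed.
Lemma qadd0 : left_id (\pi_quot 0) qadd.
Proof. by move=> u; rewrite -(reprK u) qaddE add0r. Qed.
Lemma qaddN : left_inverse (\pi_quot 0) qopp qadd.
Proof. by move=> u; rewrite -(reprK u) qoppE qaddE addNr. Qed.

HB.instance Definition _ := GRing.isZmodule.Build quot qaddA qaddC qadd0 qaddN.

Lemma qmulA : associative qmul.
Proof.
elim/quotW=> x; elim/quotW=> y; elim/quotW=> z.
by rewrite (qmulE y z) (qmulE x y) !qmulE mulrA.
Qed.
Lemma qmulC : commutative qmul.
Proof. by move=> u v; rewrite -(reprK u) -(reprK v) !qmulE mulrC. Qed.
Lemma qmul1 : left_id (\pi_quot 1) qmul.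
Proof. by move=> u; rewrite -(reprK u) qmulE mul1r. Qed.
Lemma qmulD : left_distributive qmul (+%R : quot -> quot -> quot).
Proof.
elim/quotW=> x; elim/quotW=> y; elim/quotW=> z; rewrite /GRing.add /=.
by rewrite (qaddE x y) (qmulE x z) (qmulE y z) (qmulE (x + y)) qaddE mulrDl.
Qed.

HB.instance Definition _ :=
  GRing.Zmodule_isComPzRing.Build quot qmulA qmulC qmul1 qmulD.

Definition qproj_fun (x : R) : quot := \pi_quot x.

Lemma qproj_zmod_morphism : zmod_morphism qproj_fun.
Proof.
move=> x y; rewrite /qproj_fun.
by rewrite -[RHS]/(qadd (\pi_quot x) (qopp (\pi_quot y))) qoppE qaddE.
Qed.
Lemma qproj_monoid_morphism : monoid_morphism qproj_fun.
Proof.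
split=> // x y; rewrite /qproj_fun.
by rewrite -[RHS]/(qmul (\pi_quot x) (\pi_quot y)) qmulE.
Qed.

HB.instance Definition _ :=
  GRing.isZmodMorphism.Build R quot qproj_fun qproj_zmod_morphism.
HB.instance Definition _ :=
  GRing.isMonoidMorphism.Build R quot qproj_fun qproj_monoid_morphism.

Definition qproj : {rmorphism R -> quot} := qproj_fun.

Lemma qproj_eq (x y : R) : (qproj x = qproj y) <-> I (x - y).
Proof. exact: qpi_eq. Qed.

Lemma qproj_surj (u : quot) : exists x, u = qproj x.
Proof. by exists (repr u); rewrite /qproj /= /qproj_fun reprK. Qed.

End Quotient.

Section QuotientMap.
Variables (R S : comPzRingType) (I : ideal R) (J : ideal S).
Variables (f : {rmorphism R -> S}) (fIJ : forall x, I x -> J (f x)).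

Definition qmap_fun (u : quot I) : quot J := qproj J (f (repr u)).

Lemma qmap_funE x : qmap_fun (qproj I x) = qproj J (f x).
Proof. by apply/qproj_eq; rewrite -rmorphB; apply/fIJ/qrepr. Qed.

Lemma qmap_zmod_morphism : zmod_morphism qmap_fun.
Proof.
move=> u v; have [x ->] := qproj_surj u; have [y ->] := qproj_surj v.
by rewrite -rmorphB !qmap_funE !rmorphB.
Qed.
Lemma qmap_monoid_morphism : monoid_morphism qmap_fun.
Proof.
split=> [|u v]; first by rewrite -(rmorph1 (qproj I)) qmap_funE !rmorph1.
have [x ->] := qproj_surj u; have [y ->] := qproj_surj v.
by rewrite -rmorphM !qmap_funE !rmorphM.
Qed.

HB.instance Definition _ :=
  GRing.isZmodMorphism.Build (quot I) (quot J) qmap_fun qmap_zmod_morphism.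
HB.instance Definition _ :=
  GRing.isMonoidMorphism.Build (quot I) (quot J) qmap_fun qmap_monoid_morphism.

Definition qmap : {rmorphism quot I -> quot J} := qmap_fun.

Lemma qmapE x : qmap (qproj I x) = qproj J (f x).
Proof. exact: qmap_funE. Qed.

End QuotientMap.

Arguments qproj {R} I : simpl never.
Arguments qmap {R S I J f} fIJ : simpl never.

Lemma nilradical_ideal (R : comPzRingType) :
  is_ideal [set x : R | exists n, x ^+ n = 0].
Proof.
split=> /=; first by exists 1%N; rewrite expr1.
  move=> x y [m xm] [n yn]; exists (m + n)%N.
  rewrite exprDn big1 // => i _; case: (leqP i n) => [le_in|/ltnW le_ni].
    by rewrite -addnBA // exprD xm !mul0r mul0rn.
  by rewrite -(subnKC le_ni) exprD yn mul0r mulr0 mul0rn.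
by move=> a x [n xn]; exists n; rewrite exprMn xn mulr0.
Qed.

Definition nilradical (R : comPzRingType) : ideal R :=
  Ideal (@nilradical_ideal R).

Lemma nilradical_map (R S : comPzRingType) (f : {rmorphism R -> S}) x :
  nilradical R x -> nilradical S (f x).
Proof. by case=> n xn; exists n; rewrite -rmorphXn xn rmorph0. Qed.

(* l exhibits S as the localization R[1/f]. *)
Definition is_localization (R S : comPzRingType) (f : R)
    (l : {rmorphism R -> S}) : Prop :=
  [/\ exists u : S, l f * u = 1,
      forall s : S, exists r n, s * l f ^+ n = l r
    & forall r : R, l r = 0 -> exists n, f ^+ n * r = 0].

Definition Spec (A : CRing) : setfunctor CRing := corep A.

(* Sheaf condition for the coverings {Spec R[1/f_i] -> Spec R} with finitely  *)
(* many f_i generating the unit ideal.  Compatibility is tested on all pairs  *)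
(* of maps that agree on R; this amounts to testing it on R[1/(f_i f_j)],     *)
(* the pushout of R[1/f_i] and R[1/f_j].                                      *)
Definition zariski_sheaf (X : setfunctor CRing) : Prop :=
  forall (R : comPzRingType) (n : nat) (f : 'I_n -> R)
         (S : 'I_n -> comPzRingType) (l : forall i, {rmorphism R -> S i}),
    unit_ideal (range f) ->
    (forall i, is_localization (f i) (l i)) ->
    forall x : forall i, X (S i),
      (forall (i j : 'I_n) (T : comPzRingType)
              (a : {rmorphism S i -> T}) (b : {rmorphism S j -> T}),
          rcomp a (l i) = rcomp b (l j) ->
          fmap X (a : arr (S i : CRing) T) (x i) =
          fmap X (b : arr (S j : CRing) T) (x j)) ->
      exists! y : X R,
        forall i, fmap X (l i : arr (R : CRing) (S i)) y = x i.

(* U is an open subfunctor: its preimage under any x : Spec R -> X is D(I)    *)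
(* for some ideal I of R, where D(I) consists of the maps g : R -> S for      *)
(* which g(I) generates the unit ideal of S.                                  *)
Definition open_subfunctor (X : setfunctor CRing)
    (U : forall R : CRing, set (X R)) : Prop :=
  forall (R : comPzRingType) (x : X R), exists I : ideal R,
    forall (S : comPzRingType) (g : {rmorphism R -> S}),
      U S (fmap X (g : arr (R : CRing) S) x) <-> unit_ideal (g @` I).

Definition open_immersion (U X : setfunctor CRing) (j : nattrans U X) : Prop :=
  (forall R : CRing, injective (j R)) /\
  open_subfunctor (fun R => range (j R)).

(* Open subfunctors cover X when they do so on field-valued points. *)
Definition affine_open_cover (X : setfunctor CRing) (I : Type) (A : I -> CRing)
    (j : forall i, nattrans (Spec (A i)) X) : Prop :=
  (forall i, open_immersion (j i)) /\
  forall (K : fieldType) (x : X (K : comPzRingType)),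
    exists i, range (j i (K : comPzRingType)) x.

Record scheme := Scheme {
  sch_fun :> setfunctor CRing;
  sch_sheaf : zariski_sheaf sch_fun;
  sch_cover : exists (I : Type) (A : I -> CRing)
                     (j : forall i, nattrans (Spec (A i)) sch_fun),
    affine_open_cover j
}.

(* Quasi-compact and locally Noetherian, i.e. a finite union of open spectra  *)
(* of Noetherian rings.                                                       *)
Definition noetherian_scheme (X : scheme) : Prop :=
  exists (n : nat) (A : 'I_n -> CRing) (j : forall i, nattrans (Spec (A i)) X),
    affine_open_cover j /\ forall i, noetherian_ring (A i).

Definition formally_etale (X Y : scheme) (f : nattrans X Y) : Prop :=
  forall (R : comPzRingType) (N : ideal R), nilpotent_ideal N ->
  forall (u : nattrans (Spec (quot N : comPzRingType)) X)
         (v : nattrans (Spec R) Y),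
    let i : nattrans (Spec (quot N : comPzRingType)) (Spec R) :=
      corep_map (qproj N : arr (R : CRing) (quot N : comPzRingType)) in
    nat_comp f u = nat_comp v i ->
    exists! w : nattrans (Spec R) X, nat_comp w i = u /\ nat_comp f w = v.

(* Algebras over k are rings under k, since lalgType and its descendants      *)
(* exclude the zero algebra.  Finite generation: no proper k-subalgebra       *)
(* contains the finite list s.                                                *)
Definition fin_gen_alg (k A : comPzRingType) (str : {rmorphism k -> A}) :
    Prop :=
  exists s : seq A, forall B : set A,
    (forall c, B (str c)) ->
    (forall x y, B x -> B y -> B (x + y)) ->
    (forall x y, B x -> B y -> B (x * y)) ->
    (forall x, x \in s -> B x) ->
    forall x, B x.

Record fgalg (k : comPzRingType) := FgAlg {
  alg_ring :> comPzRingType;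
  alg_str : {rmorphism k -> alg_ring};
  alg_fg : fin_gen_alg alg_str
}.

Record alghom (k : comPzRingType) (A B : fgalg k) := AlgHom {
  alghom_fun :> {rmorphism A -> B};
  alghom_str : rcomp alghom_fun (alg_str A) = alg_str B
}.

Lemma alghom_eq (k : comPzRingType) (A B : fgalg k) (f g : alghom A B) :
  f =1 g -> f = g.
Proof.
case: f g => f Hf [g Hg] /= /rmorphism_eq e.
by case: g / e Hg => Hg; congr AlgHom; apply: Prop_irrelevance.
Qed.

Program Definition alg_id (k : comPzRingType) (A : fgalg k) : alghom A A :=
  {| alghom_fun := rid A |}.
Next Obligation. by move=> k A; apply: rmorphism_eq. Qed.

Program Definition alg_comp (k : comPzRingType) (A B C : fgalg k)
    (g : alghom B C) (f : alghom A B) : alghom A C :=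
  {| alghom_fun := rcomp g f |}.
Next Obligation.
move=> k A B C g f; rewrite -(alghom_str g) -(alghom_str f).
exact: rmorphism_eq.
Qed.

Program Definition AlgFg (k : comPzRingType) : category :=
  {| obj := fgalg k;
     arr := @alghom k;
     arr_id := @alg_id k;
     arr_comp := @alg_comp k |}.
Next Obligation. by move=> k A B f; apply: alghom_eq. Qed.
Next Obligation. by move=> k A B f; apply: alghom_eq. Qed.
Next Obligation. by move=> k A B C D h g f; apply: alghom_eq. Qed.

(* Set-valued functors on k-Alg_fg, i.e. presheaves on its opposite. *)
Definition Psh (k : comPzRingType) := setfunctor (AlgFg k).

Program Definition alg_red (k : comPzRingType) (A : fgalg k) : fgalg k :=
  {| alg_ring := quot (nilradical A);
     alg_str := rcomp (qproj (nilradical A)) (alg_str A) |}.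
Next Obligation.
move=> k A; have [s sP] := alg_fg A.
exists (map (qproj (nilradical A)) s) => B Bk BD BM Bs u.
have [x ->] := qproj_surj u; move: x.
apply: (sP (fun x => B (qproj (nilradical A) x))) => [c|x y|x y|x xs].
- exact: Bk.
- by rewrite rmorphD; apply: BD.
- by rewrite rmorphM; apply: BM.
- by apply: Bs; apply: map_f.
Qed.

Program Definition red_proj (k : comPzRingType) (A : fgalg k) :
    alghom A (alg_red A) :=
  {| alghom_fun := qproj (nilradical A) |}.
Next Obligation. by []. Qed.

Program Definition red_map (k : comPzRingType) (A B : fgalg k)
    (f : alghom A B) : alghom (alg_red A) (alg_red B) :=
  {| alghom_fun := qmap (@nilradical_map _ _ f) |}.
Next Obligation.
move=> k A B f; apply: rmorphism_eq => c /=.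
rewrite -(alghom_str f); exact: (qmapE (@nilradical_map _ _ f)).
Qed.

Lemma red_mapE (k : comPzRingType) (A B : fgalg k) (f : alghom A B) (x : A) :
  red_map f (red_proj A x) = red_proj B (f x).
Proof. exact: (qmapE (@nilradical_map _ _ f)). Qed.

(* The functor A |-> F (A / sqrt 0). *)
Program Definition ImPsh (k : comPzRingType) (F : Psh k) : Psh k :=
  {| fobj := fun A : AlgFg k => F (alg_red A);
     fmap := fun (A B : AlgFg k) f =>
       fmap F (red_map f : arr (alg_red A : AlgFg k) (alg_red B)) |}.
Next Obligation.
move=> k F A x; rewrite -[RHS]fmap1; congr (fmap F _ x).
apply: alghom_eq => u; have [y ->] := qproj_surj u.
exact: (red_mapE (alg_id A)).
Qed.
Next Obligation.
move=> k F A B C g f x; rewrite /= -fmapM; congr (fmap F _ x).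
apply: alghom_eq => u; have [y ->] := qproj_surj u.
apply: (etrans (red_mapE (alg_comp g f) y)); apply/esym.
exact: (etrans (congr1 (red_map g) (red_mapE f y)) (red_mapE g (f y))).
Qed.

Program Definition Im_map (k : comPzRingType) (F G : Psh k)
    (u : nattrans F G) : nattrans (ImPsh F) (ImPsh G) :=
  {| ncomp := fun A : AlgFg k => u (alg_red A) |}.
Next Obligation.
move=> k F G u A B f x.
exact: (nat_natural u (red_map f : arr (alg_red A : AlgFg k) (alg_red B))).
Qed.

Program Definition Im_unit (k : comPzRingType) (F : Psh k) :
    nattrans F (ImPsh F) :=
  {| ncomp := fun A : AlgFg k =>
       fmap F (red_proj A : arr A (alg_red A : AlgFg k)) |}.
Next Obligation.
move=> k F A B f x; rewrite /= -!fmapM; congr (fmap F _ x).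
by apply: alghom_eq => y; apply/esym/(red_mapE f).
Qed.

(* In kcover, j i corresponds to the point j i (A i) (arr_id (A i)) of        *)
(* X (A i), whose image under kstr is the k-algebra structure that A i        *)
(* inherits from Spec (A i) being an open subscheme of X.                     *)
Record noeth_kscheme (k : comPzRingType) := NoethKScheme {
  ksch :> scheme;
  kstr : nattrans ksch (Spec k);
  knoeth : noetherian_scheme ksch;
  kcover : exists (I : Type) (A : I -> CRing)
                  (j : forall i, nattrans (Spec (A i)) ksch),
    affine_open_cover j /\
    forall i, fin_gen_alg (kstr (A i) (j i (A i) (arr_id (A i))))
}.

Record kscheme_mor (k : comPzRingType) (X Y : noeth_kscheme k) := KSchemeMor {
  kmor :> nattrans X Y;
  kmor_str : nat_comp (kstr Y) kmor = kstr X
}.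

(* A |-> the k-morphisms from Spec A to X, that is, the points of X (A) lying *)
(* over the structure map of A.                                               *)
Program Definition kpoints (k : comPzRingType) (X : noeth_kscheme k) : Psh k :=
  {| fobj := fun A : AlgFg k => {x : X (alg_ring A) | kstr X _ x = alg_str A};
     fmap := fun (A B : AlgFg k) f x =>
       exist _ (fmap X (alghom_fun f : arr (alg_ring A : CRing) (alg_ring B))
                  (sval x)) _ |}.
Next Obligation.
move=> k X A B f [x xP] /=; rewrite nat_natural xP /=; exact: alghom_str.
Qed.
Next Obligation.
by move=> k X A [x xP]; apply: eq_exist; apply: (fmap1 (s := ksch X)).
Qed.
Next Obligation.
move=> k X A B C g f [x xP]; apply: eq_exist.
exact: (fmapM (s := ksch X)).
Qed.

Program Definition kpoints_map (k : comPzRingType) (X Y : noeth_kscheme k)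
    (f : kscheme_mor X Y) : nattrans (kpoints X) (kpoints Y) :=
  {| ncomp := fun (A : AlgFg k) x =>
       exist _ (kmor f (alg_ring A) (sval x)) _ |}.
Next Obligation.
move=> k X Y f A [x xP] /=; rewrite -xP.
exact: (congr1 (fun u : nattrans X (Spec k) => u (alg_ring A) x) (kmor_str f)).
Qed.
Next Obligation.
by move=> k X Y f A B g [x xP]; apply: eq_exist; apply: nat_natural.
Qed.

(* Main.v *)
From HB Require Import structures.
Require Import Defs.
From mathcomp Require Import all_boot all_algebra.
From mathcomp Require Import boolp classical_sets ring.

(* By the Yoneda lemma, both conditions say that X(R) -> X(R/N) x_Y(R/N) Y(R) *)
(* is bijective: for all rings R and nilpotent N in the first case, for       *)
(* finitely generated k-algebras R with N their nilradical in the second.     *)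
(* The nilradical of a finitely generated k-algebra is nilpotent by Hilbert's *)
(* basis theorem, whence one direction.                                       *)
(*   For the converse, take first N the nilradical of an arbitrary R, and     *)
(* points of X(R/N) and Y(R) in affine opens Spec A and Spec B.  A and B are  *)
(* finitely generated, so the two points, and the equality of their images in *)
(* Y(R/N), descend to a finitely generated subalgebra C of R, because the map *)
(* from C modulo its nilradical to R/N is injective; the lift exists over C,  *)
(* and uniqueness descends in the same way.  General points are of this kind  *)
(* locally on Spec R, and the local lifts glue by uniqueness.  Finally, an    *)
(* arbitrary N is handled by the tower R -> R/N -> R/sqrt 0.                  *)

Set Implicit Arguments.
Unset Strict Implicit.
Unset Printing Implicit Defensive.

Import GRing.Theory.
Local Open Scope classical_set_scope.
Local Open Scope ring_scope.
Local Open Scope quotient_scope.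

(** * Ideals and localization *)

(** Both conditions are cases of [unique_lifting]: [formally_etaleP] puts it for all nilpotent N,
    [is_pullback_pointwise] reduces the other to reductions of finitely generated algebras.
    [fgalg_nilradical] then gives the forward implication. The converse rests on descent to a
    finitely generated subalgebra, so all data must be witnessed by finitely many elements: the
    images of the generators of two charts and, by [open_finite_witness], the membership of a point
    in an open subfunctor. Moreover a point whose reduction lies in a chart lies in it itself
    ([open_red]), so lifts can be compared inside charts. [local_lift_exists] and
    [local_lift_unique] carry this out, [unique_lifting_redp] glues over localizations that are
    found by testing on field-valued points, and [unique_lifting_of_red] passes from nilradicals to
    nilpotent ideals. *)

Lemma ideal_gen_ideal (R : comPzRingType) (E : set R) : is_ideal (ideal_gen E).
Proof.
split=> [J _|x y Ex Ey J EJ|a x Ex J EJ]; first exact: ideal0.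
- by apply: idealD; [apply: Ex|apply: Ey].
- by apply: idealMl; apply: Ex.
Qed.

Lemma sub_ideal_gen (R : comPzRingType) (E : set R) : E `<=` ideal_gen E.
Proof. by move=> x Ex J; apply. Qed.

Lemma preimage_ideal (R S : comPzRingType) (f : {rmorphism R -> S})
  (J : ideal S) : is_ideal [set x | J (f x)].
Proof.
split=> [|x y|a x] /=; first by rewrite rmorph0; apply: ideal0.
- by rewrite rmorphD; apply: idealD.
- by rewrite rmorphM; apply: idealMl.
Qed.

Lemma unit_ideal_image (R S : comPzRingType) (f : {rmorphism R -> S})
  (E : set R) : unit_ideal E -> unit_ideal (f @` E).
Proof.
move=> E1 J EJ; have := E1 (Ideal (preimage_ideal f J)); rewrite /= rmorph1.
by apply=> x Ex; apply: EJ; exists x.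
Qed.

Lemma unit_ideal_unit (R : comPzRingType) (E : set R) (x y : R) :
  E x -> x * y = 1 -> unit_ideal E.
Proof. by move=> Ex xy J EJ; rewrite -xy mulrC; apply/idealMl/EJ. Qed.

(** The finite sum is what makes Spec quasi-compact and what allows open conditions to descend to
    finitely generated subrings. *)
Lemma ideal_genP (R : comPzRingType) (E : set R) (x : R) : ideal_gen E x ->
  exists s : seq (R * R),
    (forall p, p \in s -> E p.2) /\ x = \sum_(p <- s) p.1 * p.2.
Proof.
set J : set R := [set x | exists s : seq (R * R),
    (forall p, p \in s -> E p.2) /\ x = \sum_(p <- s) p.1 * p.2].
have JI : is_ideal J.
  split=> [|y z [s [sE ->]] [t [tE ->]]|a y [s [sE ->]]].
  - by exists [::]; rewrite big_nil; split.
  - exists (s ++ t); rewrite big_cat; split=> // p; rewrite mem_cat.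
    by case/orP; [apply: sE|apply: tE].
  - exists [seq (a * p.1, p.2) | p <- s]; split=> [_ /mapP[p ps ->]|].
      exact: (sE _ ps).
    by rewrite big_map mulr_sumr; apply: eq_bigr => p _; rewrite mulrA.
move=> /(_ (Ideal JI)); apply=> y Ey; exists [:: (1, y)]; split=> [p|].
  by rewrite inE => /eqP ->.
by rewrite big_seq1 mul1r.
Qed.

Lemma unit_ideal_finite (R : comPzRingType) (E : set R) : unit_ideal E ->
  exists (n : nat) (h : 'I_n -> R), (forall i, E (h i)) /\ unit_ideal (range h).
Proof.
case/ideal_genP=> s [sE s1].
exists (size s), (fun i => (tnth (in_tuple s) i).2); split=> [i|J hJ].
  by apply: sE; apply: mem_tnth.
rewrite s1 big_tnth.
have [J0 JD JM] := idealP J.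
by apply: big_ind => // i _; apply/JM/hJ; exists i.
Qed.

(* The localization R[1/h]: a pair (r, n) stands for r / h ^ n. *)
Section Localization.
Variables (R : comPzRingType) (h : R).

(** The factor [h ^+ p] makes the relation transitive when h is a zero divisor. *)
Let fracE (x y : R * nat) : Prop :=
  exists p, h ^+ p * (h ^+ y.2 * x.1) = h ^+ p * (h ^+ x.2 * y.1).

Definition frac_equiv (x y : R * nat) : bool := `[< fracE x y >].

Lemma frac_equiv_refl : reflexive frac_equiv.
Proof. by move=> x; apply/asboolP; exists 0%N. Qed.
Lemma frac_equiv_sym : symmetric frac_equiv.
Proof. by move=> x y; apply/asboolP/asboolP => -[p e]; exists p. Qed.
Lemma frac_equiv_trans : transitive frac_equiv.
Proof.
move=> [y n] [x m] [z l] /asboolP[p /= e] /asboolP[q /= e']; apply/asboolP.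
exists (p + q + n)%N; rewrite /= !exprD.
have -> : h ^+ p * h ^+ q * h ^+ n * (h ^+ l * x)
  = h ^+ q * h ^+ l * (h ^+ p * (h ^+ n * x)) by ring.
rewrite e.
have -> : h ^+ q * h ^+ l * (h ^+ p * (h ^+ m * y))
  = h ^+ p * h ^+ m * (h ^+ q * (h ^+ l * y)) by ring.
rewrite e'; ring.
Qed.

Canonical frac_equiv_rel :=
  EquivRel frac_equiv frac_equiv_refl frac_equiv_sym frac_equiv_trans.

Definition localization : Type := {eq_quot frac_equiv}.
HB.instance Definition _ : EqQuotient (R * nat)%type frac_equiv localization :=
  EqQuotient.on localization.
HB.instance Definition _ := Choice.on localization.

Definition frac (r : R) (n : nat) : localization := \pi_localization (r, n).

Lemma frac_eq r n s m :
  (frac r n = frac s m) <->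
  exists p, h ^+ p * (h ^+ m * r) = h ^+ p * (h ^+ n * s).
Proof.
split=> [/eqP|e]; first by rewrite piE => /asboolP.
by apply/eqP; rewrite piE; apply/asboolP.
Qed.

Lemma fracP (u : localization) : exists r n, u = frac r n.
Proof. by case E : (repr u) => [r n]; exists r, n; rewrite /frac -E reprK. Qed.

Definition loc_add (u v : localization) : localization :=
  let x := repr u in let y := repr v in
  frac (h ^+ y.2 * x.1 + h ^+ x.2 * y.1) (x.2 + y.2).
Definition loc_opp (u : localization) : localization :=
  let x := repr u in frac (- x.1) x.2.
Definition loc_mul (u v : localization) : localization :=
  let x := repr u in let y := repr v in frac (x.1 * y.1) (x.2 + y.2).

Let reprE r n : exists p,
  let x := repr (frac r n) in
  h ^+ p * (h ^+ n * x.1) = h ^+ p * (h ^+ x.2 * r).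
Proof. by apply/frac_eq; rewrite /frac -surjective_pairing reprK. Qed.

Lemma loc_addE r n s m :
  loc_add (frac r n) (frac s m) = frac (h ^+ m * r + h ^+ n * s) (n + m).
Proof.
rewrite /loc_add; move: (reprE r n) (reprE s m).
case: (repr _) => [r' n'] [p /= e]; case: (repr _) => [s' m'] [q /= e'].
apply/frac_eq; exists (p + q)%N; rewrite !exprD.
transitivity (h ^+ q * h ^+ m' * h ^+ m * (h ^+ p * (h ^+ n * r'))
  + h ^+ p * h ^+ n' * h ^+ n * (h ^+ q * (h ^+ m * s'))); first by ring.
by rewrite e e'; ring.
Qed.
Lemma loc_oppE r n : loc_opp (frac r n) = frac (- r) n.
Proof.
rewrite /loc_opp; move: (reprE r n); case: (repr _) => [r' n'] [p /= e].
by apply/frac_eq; exists p; rewrite !mulrN e.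
Qed.
Lemma loc_mulE r n s m :
  loc_mul (frac r n) (frac s m) = frac (r * s) (n + m).
Proof.
rewrite /loc_mul; move: (reprE r n) (reprE s m).
case: (repr _) => [r' n'] [p /= e]; case: (repr _) => [s' m'] [q /= e'].
apply/frac_eq; exists (p + q)%N; rewrite !exprD.
transitivity ((h ^+ p * (h ^+ n * r')) * (h ^+ q * (h ^+ m * s'))).
  by ring.
by rewrite e e'; ring.
Qed.

Lemma loc_addA : associative loc_add.
Proof.
move=> u v w; have [r [n ->]] := fracP u; have [s [m ->]] := fracP v.
have [t [l ->]] := fracP w; rewrite !loc_addE addnA.
by congr frac; rewrite !exprD; ring.
Qed.
Lemma loc_addC : commutative loc_add.
Proof.
move=> u v; have [r [n ->]] := fracP u; have [s [m ->]] := fracP v.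
by rewrite !loc_addE addnC addrC.
Qed.
Lemma loc_add0 : left_id (frac 0 0) loc_add.
Proof.
move=> u; have [r [n ->]] := fracP u.
by rewrite loc_addE mulr0 mul1r add0r add0n.
Qed.
Lemma loc_addN : left_inverse (frac 0 0) loc_opp loc_add.
Proof.
move=> u; have [r [n ->]] := fracP u; rewrite loc_oppE loc_addE.
by apply/frac_eq; exists 0%N; ring.
Qed.

HB.instance Definition _ :=
  GRing.isZmodule.Build localization loc_addA loc_addC loc_add0 loc_addN.

Lemma loc_mulA : associative loc_mul.
Proof.
move=> u v w; have [r [n ->]] := fracP u; have [s [m ->]] := fracP v.
by have [t [l ->]] := fracP w; rewrite !loc_mulE addnA mulrA.
Qed.
Lemma loc_mulC : commutative loc_mul.
Proof.
move=> u v; have [r [n ->]] := fracP u; have [s [m ->]] := fracP v.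
by rewrite !loc_mulE addnC mulrC.
Qed.
Lemma loc_mul1 : left_id (frac 1 0) loc_mul.
Proof.
by move=> u; have [r [n ->]] := fracP u; rewrite loc_mulE mul1r add0n.
Qed.
Lemma loc_mulD :
  left_distributive loc_mul (+%R : localization -> localization -> localization).
Proof.
move=> u v w; have [r [n ->]] := fracP u; have [s [m ->]] := fracP v.
have [t [l ->]] := fracP w.
rewrite -[_ + _ in LHS]/(loc_add _ _) -[RHS]/(loc_add _ _).
rewrite loc_addE !loc_mulE loc_addE; apply/frac_eq; exists 0%N.
by rewrite !exprD; ring.
Qed.

HB.instance Definition _ :=
  GRing.Zmodule_isComPzRing.Build localization
    loc_mulA loc_mulC loc_mul1 loc_mulD.

Definition loc_map_fun (r : R) : localization := frac r 0.

Lemma loc_map_zmod_morphism : zmod_morphism loc_map_fun.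
Proof.
move=> x y; rewrite -[RHS]/(loc_add (frac x 0) (loc_opp (frac y 0))).
by rewrite loc_oppE loc_addE !mul1r.
Qed.
Lemma loc_map_monoid_morphism : monoid_morphism loc_map_fun.
Proof.
by split=> // x y; rewrite -[RHS]/(loc_mul (frac x 0) (frac y 0)) loc_mulE.
Qed.

HB.instance Definition _ :=
  GRing.isZmodMorphism.Build R localization loc_map_fun loc_map_zmod_morphism.
HB.instance Definition _ :=
  GRing.isMonoidMorphism.Build R localization loc_map_fun
    loc_map_monoid_morphism.

Definition loc_map : {rmorphism R -> localization} := loc_map_fun.

Lemma loc_mapP : is_localization h loc_map.
Proof.
split.
- exists (frac 1 1); rewrite -[LHS]/(loc_mul (frac h 0) (frac 1 1)) loc_mulE.
  by apply/frac_eq; exists 0%N; ring.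
- move=> u; have [r [n ->]] := fracP u; exists r, n.
  rewrite -rmorphXn -[LHS]/(loc_mul (frac r n) (frac (h ^+ n) 0)) loc_mulE.
  by apply/frac_eq; exists 0%N; rewrite addn0; ring.
- by move=> r /frac_eq[p]; rewrite !expr0 mulr0 mulr0 mul1r => e; exists p.
Qed.

End Localization.

(** * Maximal ideals *)

Definition maximal_ideal (R : comPzRingType) (m : ideal R) : Prop :=
  ~ m 1 /\ forall x, ~ m x -> exists a, m (1 - a * x).

Lemma maximal_ideal_exists (R : comPzRingType) (E : set R) : ~ unit_ideal E ->
  exists m : ideal R, maximal_ideal m /\ E `<=` m.
Proof.
move=> E1; have [I0 ID IM] := ideal_gen_ideal E.
(* Zorn's lemma is applied to all chains, the empty one included, so [P] must admit the empty set;
   the last clause therefore speaks of inhabited sets only. *)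
pose P : set (set R) := [set A | [/\ forall x y, A x -> A y -> A (x + y),
  forall a x, A x -> A (a * x), ~ A 1
  & (exists x, A x) -> ideal_gen E `<=` A]].
have [F FP Ftot|m [[mD mM m1 mE] mmax]] := @Zorn_bigcup R P.
  split=> [x y [A FA Ax] [B FB By]|a x [A FA Ax]|[A FA A1]|[x [A FA Ax]]].
  - have [AB|BA] := Ftot _ _ FA FB.
      by exists B => //; case: (FP _ FB) => + _ _ _; apply => //; apply: AB.
    by exists A => //; case: (FP _ FA) => + _ _ _; apply => //; apply: BA.
  - by exists A => //; case: (FP _ FA) => _ + _ _; apply.
  - by case: (FP _ FA).
  - move=> y Ey; exists A => //; case: (FP _ FA) => _ _ _; apply=> //.
    by exists x.
(* A maximal m is inhabited, since otherwise [ideal_gen E] would be a larger member of [P]. *)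
have mex : exists x, m x.
  apply: contrapT => m0; apply: (mmax (ideal_gen E)); last by split=> [|||_].
  split=> [x mx|]; first by case: m0; exists x.
  by move=> /(_ 0 I0) m00; apply: m0; exists 0.
have {}mE := mE mex; have mI : is_ideal m by split=> //; apply/mE.
exists (Ideal mI); split; last by apply: subset_trans mE; apply: sub_ideal_gen.
split=> // x mx; apply: contrapT => x1.
(* This set is the ideal m + (x). *)
apply: (mmax [set z | exists a, m (z - a * x)]).
  split=> [z mz|/(_ x) xm]; first by exists 0; rewrite mul0r subr0.
  by apply/mx/xm; exists 1; rewrite mul1r subrr; apply/mE.
split=> [y z [a ya] [b zb]|a z [b zb]|[a xa]|_ z Ez].
- by exists (a + b); rewrite mulrDl opprD addrACA; apply: mD.
- by exists (a * b); rewrite -mulrA -mulrBr; apply: mM.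
- by apply: x1; exists a.
- by exists 0; rewrite mul0r subr0; apply: mE.
Qed.

Section ResidueField.
Variables (R : comPzRingType) (m : ideal R) (mmax : maximal_ideal m).

(** The proof of maximality is a parameter of the type, so that the field structure can be attached
    to it. *)
Definition residue_ring of maximal_ideal m : Type := quot m.
Local Notation K := (residue_ring mmax).

HB.instance Definition _ := GRing.ComPzRing.on K.

Lemma residue_oner_neq0 : (1 : K) != 0.
Proof.
apply/eqP => /(qproj_eq m 1 0); rewrite subr0.
by case: mmax.
Qed.

HB.instance Definition _ :=
  GRing.PzSemiRing_isNonZero.Build K residue_oner_neq0.

Definition residue_inv (u : K) : K :=
  if pselect (exists v : K, v * u = 1) is left e then projT1 (cid e) else 0.

Lemma residue_mulVf (u : K) : u != 0 -> residue_inv u * u = 1.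
Proof.
move=> u0; rewrite /residue_inv; case: pselect => [e|[]]; first by case: cid.
have [x ux] := qproj_surj (u : quot m).
have /(proj2 mmax)[a ax] : ~ m x.
  move=> mx; case/eqP: u0; rewrite ux; apply/(qproj_eq m x 0).
  by rewrite subr0.
exists (qproj m a : K); rewrite ux -[LHS](rmorphM (qproj m)).
by apply/esym/(qproj_eq m 1 (a * x)).
Qed.

Lemma residue_invr0 : residue_inv 0 = 0.
Proof.
rewrite /residue_inv; case: pselect => // e; case: cid => v /= /eqP.
by rewrite mulr0 eq_sym (negPf residue_oner_neq0).
Qed.

HB.instance Definition _ :=
  GRing.ComNzRing_isField.Build K residue_mulVf residue_invr0.

Definition residue_field : fieldType := K.

Definition residue_map : {rmorphism R -> residue_field} :=
  (qproj m : {rmorphism R -> (K : comPzRingType)}).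

End ResidueField.

(** If E were contained in a maximal ideal, all of E would vanish in the residue field. This turns
    covers tested on field-valued points into covers of Spec R. *)
Lemma unit_ideal_field (R : comPzRingType) (E : set R) :
  (forall (K : fieldType) (f : {rmorphism R -> K}), exists2 x, E x & f x != 0) ->
  unit_ideal E.
Proof.
move=> EK; apply: contrapT => /maximal_ideal_exists[m [mmax Em]].
have [x Ex /eqP[]] := EK _ (residue_map mmax).
by rewrite -(rmorph0 (residue_map mmax)); apply/qproj_eq; rewrite subr0; apply: Em.
Qed.

(** * Subalgebras generated by finitely many elements *)

Lemma factor_injective (A S T : comPzRingType) (i : {rmorphism S -> T})
    (a : {rmorphism A -> T}) :
  injective i -> (forall x, exists y, i y = a x) ->
  exists b : {rmorphism A -> S}, forall x, i (b x) = a x.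
Proof.
move=> inj_i /choice[b bP].
have bB : zmod_morphism b by move=> x y; apply: inj_i; rewrite rmorphB !bP rmorphB.
have bM : monoid_morphism b.
  by split=> [|x y]; apply: inj_i; rewrite ?rmorphM !bP ?rmorph1 ?rmorphM.
pose bA := GRing.isZmodMorphism.Build A S b bB.
pose bR := GRing.isMonoidMorphism.Build A S b bM.
by exists (HB.pack_for {rmorphism A -> S} b bA bR).
Qed.

Definition alg_generated (k A : comPzRingType) (str : {rmorphism k -> A})
    (s : seq A) : Prop :=
  forall B : set A,
    (forall c, B (str c)) ->
    (forall x y, B x -> B y -> B (x + y)) ->
    (forall x y, B x -> B y -> B (x * y)) ->
    (forall x, x \in s -> B x) ->
    forall x, B x.

Section Subalgebra.
Variables (k R : comPzRingType) (str : {rmorphism k -> R}) (s : seq R).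

Let alg_closed (B : set R) : Prop :=
  [/\ forall c, B (str c), forall x y, B x -> B y -> B (x + y),
      forall x y, B x -> B y -> B (x * y) & forall x, x \in s -> B x].

Definition subalg (x : R) : bool :=
  `[< forall B : set R, alg_closed B -> B x >].

Let subalg_closedP : alg_closed (fun x => subalg x).
Proof.
split=> [c|x y /asboolP hx /asboolP hy|x y /asboolP hx /asboolP hy|x xs];
  apply/asboolP => B HB; have [Bk BD BM Bs] := HB => //.
- by apply: BD; [apply: hx|apply: hy].
- by apply: BM; [apply: hx|apply: hy].
- exact: Bs.
Qed.

Lemma subalg_subring_closed : subring_closed subalg.
Proof.
have [Bk BD BM _] := subalg_closedP.
split=> [|x y hx hy|x y hx hy]; first by rewrite -[1](rmorph1 str); apply: Bk.
  apply: BD => //; rewrite -mulN1r -[-1](rmorphN1 str).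
  by apply: BM.
exact: BM.
Qed.

Definition subalg_ring : Type := {x : R | subalg x}.
HB.instance Definition _ := SubChoice.on subalg_ring.
HB.instance Definition _ :=
  GRing.SubChoice_isSubComPzRing.Build R subalg subalg_ring
    subalg_subring_closed.

(** The subalgebra is presented as a ring with an injection, so that it can serve as a new base ring
    or as an object of [fgalg k]. *)
Lemma subalgebra_exists :
  exists (C : comPzRingType) (strC : {rmorphism k -> C})
    (i : {rmorphism C -> R}) (t : seq C),
    [/\ injective i, rcomp i strC = str, map i t = s & alg_generated strC t].
Proof.
pose i : {rmorphism subalg_ring -> R} := val.
have inj_i : injective i by apply: val_inj.
have [Sk _ _ Ss] := subalg_closedP.
have [strC strCE] : exists b : {rmorphism k -> subalg_ring},
    forall x, i (b x) = str x.
  by apply: factor_injective => // c; exists (Sub (str c) (Sk c)); apply: SubK.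
pose t : seq subalg_ring := pmap insub s.
have tE : map i t = s.
  rewrite /t pmap_filter; last exact: insubK.
  apply/all_filterP/allP => x xs.
  by rewrite isSome_insub; apply: Ss.
exists subalg_ring, strC, i, t; split=> //; first exact: rmorphism_eq.
move=> B Bk BD BM Bt u.
(* The image of B in R is closed and contains s, hence contains every element of [subalg];
   injectivity of [i] brings this back to B. *)
suff : exists2 v, i v = i u & B v by case=> v /inj_i ->.
have /asboolP/(_ [set x | exists2 v, i v = x & B v]) := valP u.
apply; split=> [c|x y|x y|x xs].
- by exists (strC c).
- move=> [v <- Bv] [w <- Bw]; exists (v + w); first exact: rmorphD.
  exact: BD.
- move=> [v <- Bv] [w <- Bw]; exists (v * w); first exact: rmorphM.
  exact: BM.
- move: xs; rewrite -tE => /mapP[v vt ->]; exists v => //.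
  exact: Bt.
Qed.

End Subalgebra.

(** * Hilbert's basis theorem *)

(* The filtration F n of S by the sums of f (c i) * x ^+ i over i < n replaces *)
(* the degree of polynomials, and the ideals L n of n-th coefficients of       *)
(* elements of I in F n.+1 replace those of leading coefficients.              *)
Section HilbertBasis.
Variables (R S : comPzRingType) (f : {rmorphism R -> S}) (x : S).
Hypothesis Rnoeth : noetherian_ring R.
Hypothesis Sgen : alg_generated f [:: x].

Fixpoint adjoin_filtration (n : nat) : set S :=
  if n is m.+1 then [set p | exists c, adjoin_filtration m (p - f c * x ^+ m)]
  else [set 0].
Local Notation F := adjoin_filtration.

Let F0 n : F n 0.
Proof.
elim: n => //= n IH; exists 0.
by rewrite rmorph0 mul0r subr0.
Qed.

Let FD n p q : F n p -> F n q -> F n (p + q).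
Proof.
elim: n p q => /= [p q -> ->|n IH p q [c pc] [d qd]]; first by rewrite addr0.
by exists (c + d); rewrite rmorphD mulrDl opprD addrACA; apply: IH.
Qed.

Let FZ n c p : F n p -> F n (f c * p).
Proof.
elim: n p => /= [p ->|n IH p [d pd]]; first by rewrite mulr0.
by exists (c * d); rewrite rmorphM -mulrA -mulrBr; apply: IH.
Qed.

Let FN n p : F n p -> F n (- p).
Proof. by rewrite -mulN1r -(rmorphN1 f); apply: FZ. Qed.

Let FS n p : F n p -> F n.+1 p.
Proof. by move=> np; exists 0; rewrite rmorph0 mul0r subr0. Qed.

Let F_mono m n p : (m <= n)%N -> F m p -> F n p.
Proof. by move/subnK <-; elim: (n - m)%N => // d IH /IH; apply: FS. Qed.

Let FX m n p : F n p -> F (m + n)%N (x ^+ m * p).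
Proof.
elim: m n p => [|m IH] n p np; first by rewrite mul1r.
rewrite exprSr -mulrA addSnnS; apply: IH.
elim: n p np => /= [p ->|n IH p [c /IH pc]].
  by exists 0; rewrite !(mulr0, mul0r, rmorph0, subr0).
exists c; move: pc; rewrite mulrBr exprS.
by rewrite [x * (f c * _)]mulrCA.
Qed.

Let FM m n p q : F m p -> F n q -> F (m + n)%N (p * q).
Proof.
elim: m p => [p -> _|m IH p [c pc] nq]; first by rewrite mul0r.
rewrite -(subrK (f c * x ^+ m) p) mulrDl; apply: FD.
  exact/FS/IH.
by rewrite -mulrA; apply/FZ/FS/FX.
Qed.

Let F_all p : exists n, F n p.
Proof.
apply: (Sgen (B := [set p | exists n, F n p])) => [c|q r [m mq] [n nr]||y].
- by exists 1%N, c; rewrite mulr1 subrr.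
- exists (m + n)%N; apply: FD; first exact: F_mono (leq_addr _ _) mq.
  exact: F_mono (leq_addl _ _) nr.
- by move=> q r [m mq] [n nr]; exists (m + n)%N; apply: FM.
- rewrite inE => /eqP ->; exists 2, 1; rewrite rmorph1 mul1r subrr.
  exact: F0.
Qed.

Variable I : ideal S.

(** Coefficients need not be unique, as S is only generated by x; c counts as an n-th coefficient of
    p whenever the difference lies in [F n]. *)
Let L n : set R := [set c | exists2 p, I p & F n (p - f c * x ^+ n)].

Let L_ideal n : is_ideal (L n).
Proof.
split=> [|c d [p Ip pc] [q Iq qd]|a c [p Ip pc]].
- by exists 0; rewrite ?rmorph0 ?mul0r ?subr0//; apply: ideal0.
- exists (p + q); first exact: idealD.
  by rewrite rmorphD mulrDl opprD addrACA; apply: FD.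
- exists (f a * p); first exact: idealMl.
  by rewrite rmorphM -mulrA -mulrBr; apply: FZ.
Qed.

Let L_shift d n p c : F n (p - f c * x ^+ n) ->
  F (d + n)%N (x ^+ d * p - f c * x ^+ (d + n)).
Proof. by move/(FX d); rewrite mulrBr mulrCA exprD. Qed.

Let L_mono m n : (m <= n)%N -> L m `<=` L n.
Proof.
move/subnK <- => c [p Ip pc]; exists (x ^+ (n - m) * p); first exact: idealMl.
exact: L_shift.
Qed.

(** The union of the increasing ideals [L n] is finitely generated, and its generators all occur at
    one level m. *)
Let L_stable : exists m, forall n, L n `<=` L m.
Proof.
have LI : is_ideal [set c | exists n, L n c].
  split=> [|c d [m mc] [n nd]|a c [n nc]].
  - by exists 0%N; have [] := L_ideal 0.
  - exists (m + n)%N; have [_ + _] := L_ideal (m + n); apply.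
      exact: L_mono (leq_addr _ _) _ mc.
    exact: L_mono (leq_addl _ _) _ nd.
  - by exists n; have [_ _] := L_ideal n; apply.
have [t tP] := Rnoeth (Ideal LI).
have tL c : c \in t -> exists n, L n c.
  move=> ct; rewrite -[exists n, _]/((Ideal LI : set R) c).
  by rewrite [X in X c]tP; apply: sub_ideal_gen.
have [m mP] : exists m, forall c, c \in t -> L m c.
  elim: t tL {tP} => [|c t IH] tL; first by exists 0%N.
  have [m mt] := IH (fun d dt => tL d (@mem_behead _ (c :: t) d dt)).
  have [n nc] := tL c (mem_head c t); exists (m + n)%N => d.
  rewrite inE => /predU1P[->|/mt]; first exact: L_mono (leq_addl _ _) _ nc.
  exact: L_mono (leq_addr _ _) _.
exists m => n c nc.
have : (Ideal LI : set R) c by exists n.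
by rewrite [X in X c]tP => /(_ (Ideal (L_ideal m))); apply => d /mP.
Qed.

Let L_gen n : exists2 s : seq S, (forall p, p \in s -> I p) &
  forall c, L n c ->
    exists2 q, ideal_gen [set p | p \in s] q & F n (q - f c * x ^+ n).
Proof.
have [t tP] := Rnoeth (Ideal (L_ideal n)).
have tL c : c \in t -> L n c.
  by move=> ct; rewrite -[L n]/(Ideal (L_ideal n) : set R) tP; apply: sub_ideal_gen.
have [s sI sP] : exists2 s : seq S, (forall p, p \in s -> I p) &
    forall c, c \in t -> exists2 q, q \in s & F n (q - f c * x ^+ n).
  elim: t tL {tP} => [|c t IH] tL; first by exists [::].
  have [s sI sP] := IH (fun d dt => tL d (@mem_behead _ (c :: t) d dt)).
  have [p Ip pc] := tL c (mem_head c t); exists (p :: s) => [q|d].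
    by rewrite inE => /predU1P[->//|]; apply: sI.
  rewrite inE => /predU1P[->|/sP[q qs qd]]; first by exists p; rewrite ?mem_head.
  by exists q; rewrite // inE qs orbT.
exists s => // c nc; have [G0 GD GM] := ideal_gen_ideal [set p | p \in s].
have JI : is_ideal [set c | exists2 q, ideal_gen [set p | p \in s] q
                                     & F n (q - f c * x ^+ n)].
  split=> [|a b [p Gp pa] [q Gq qb]|a b [q Gq qb]].
  - by exists 0; rewrite ?rmorph0 ?mul0r ?subr0.
  - exists (p + q); first exact: GD.
    by rewrite rmorphD mulrDl opprD addrACA; apply: FD.
  - exists (f a * q); first exact: GM.
    by rewrite rmorphM -mulrA -mulrBr; apply: FZ.
have : (Ideal (L_ideal n) : set R) c by [].
rewrite tP => /(_ (Ideal JI)); apply=> d /sP[q qs qd]; exists q => //.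
exact: sub_ideal_gen.
Qed.

(** By induction on n: [L_gen] supplies a combination of finitely many elements of I with the same
    top coefficient as p, and subtracting it lowers the filtration. *)
Let F_gen n : exists2 s : seq S, (forall p, p \in s -> I p) &
  forall p, I p -> F n p -> ideal_gen [set p | p \in s] p.
Proof.
elim: n => [|n [s sI sP]].
  by exists [::] => // p _ ->; have [] := ideal_gen_ideal [set p : S | p \in [::]].
have [t tI tP] := L_gen n; exists (s ++ t) => [p|p Ip [c pc]].
  by rewrite mem_cat => /orP[/sI|/tI].
have stP (E : seq S) : {subset E <= s ++ t} ->
    ideal_gen [set p | p \in E] `<=` ideal_gen [set p | p \in s ++ t].
  by move=> sE r Er J HJ; apply: Er => z Ez; apply/HJ/sE.
have [|q Gq qc] := tP c; first by exists p.
have Iq : I q by apply: Gq.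
have [_ GD _] := ideal_gen_ideal [set p | p \in s ++ t].
rewrite -(subrK q p); apply: GD; last first.
  by apply: stP Gq => z; rewrite mem_cat orbC => ->.
apply: (stP s) => [z|]; first by rewrite mem_cat => ->.
apply: sP; first by apply: idealD => //; apply: idealN.
have -> : p - q = (p - f c * x ^+ n) - (q - f c * x ^+ n) by ring.
by apply: FD => //; apply: FN.
Qed.

Lemma noetherian_adjoin_ideal :
  exists s : seq S, ideal_set I = ideal_gen [set x | x \in s].
Proof.
have [m mL] := L_stable; have [s sI sP] := F_gen m.+1.
exists s; apply/seteqP; split=> [p Ip|p]; last by apply.
have [n np] := F_all p; have [_ GD GM] := ideal_gen_ideal [set p | p \in s].
elim: n p Ip np => [p Ip /= ->|n IH p Ip [c pc]].
  by have [] := ideal_gen_ideal [set p | p \in s].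
case: (leqP n m) => [nm|mn].
  by apply: sP => //; apply: (@F_mono n.+1) => //; exists c.
have /mL[q Iq qc] : L n c by exists p.
(* [r] lies in I, shares the n-th coefficient c with [p], and is generated by s because [q] lies in
   [F m.+1]; so [p - r] is one step lower. *)
set r := x ^+ (n - m) * q.
have Gr : ideal_gen [set p | p \in s] r.
  by apply/GM/sP => //; exists c.
have rc : F n (r - f c * x ^+ n).
  by have := L_shift (n - m) qc; rewrite subnK // ltnW.
rewrite -(subrK r p); apply: GD => //; apply: IH.
  by apply: idealD => //; apply/idealN/idealMl.
have -> : p - r = (p - f c * x ^+ n) - (r - f c * x ^+ n) by ring.
by apply: FD => //; apply: FN.
Qed.

End HilbertBasis.

(** * Finitely generated algebras and nilpotence of their nilradicals *)

Lemma noetherian_field (k : fieldType) : noetherian_ring k.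
Proof.
move=> I; have [[c Ic c0]|I0] := pselect (exists2 c, I c & c != 0).
  exists [:: 1]; apply/seteqP; split=> [x _ J J1|x _].
    by rewrite -[x]mulr1; apply/idealMl/J1; rewrite /= mem_head.
  by rewrite -[x](mulfVK c0); apply: idealMl.
exists [::]; apply/seteqP; split=> [x Ix|x]; last by apply.
have -> : x = 0 by apply: contrapT => /eqP x0; apply: I0; exists x.
by have [] := ideal_gen_ideal [set y : k | y \in [::]].
Qed.

Lemma noetherian_surj (R S : comPzRingType) (f : {rmorphism R -> S}) :
  (forall y, exists x, f x = y) -> noetherian_ring R -> noetherian_ring S.
Proof.
move=> fsurj Rn I; have [s sP] := Rn (Ideal (preimage_ideal f I)).
exists (map f s); apply/seteqP; split=> [y Iy|y]; last first.
  apply=> _ /mapP[x xs ->]; rewrite -[I _]/((Ideal (preimage_ideal f I) : set R) x).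
  by rewrite [X in X x]sP; apply: sub_ideal_gen.
move: Iy; have [x <-] := fsurj y => Ix J Js.
have : (Ideal (preimage_ideal f I) : set R) x by [].
rewrite [X in X x]sP => /(_ (Ideal (preimage_ideal f J))); apply=> z zs.
exact/Js/map_f.
Qed.

(** By induction on the number of generators: A is a quotient of k if there are none, and otherwise
    C[x] with C the subalgebra generated by the tail. *)
Lemma noetherian_alg_generated (k A : comPzRingType) (str : {rmorphism k -> A})
    (s : seq A) :
  noetherian_ring k -> alg_generated str s -> noetherian_ring A.
Proof.
move=> kn; move sn : (size s) => n.
elim: n A str s sn => [|n IH] A str [|x s] //= => [_|[sn]] sgen.
  apply: (noetherian_surj (f := str)) => // y.
  apply: (sgen [set y | exists c, str c = y]) => [c|_ _ [c <-] [d <-]||//].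
  - by exists c.
  - by exists (c + d); rewrite rmorphD.
  - by move=> _ _ [c <-] [d <-]; exists (c * d); rewrite rmorphM.
have [C [strC [i [t [_ iC tE tgen]]]]] := subalgebra_exists str s.
have Cn : noetherian_ring C.
  by apply: (IH C strC t) => //; rewrite -sn -tE size_map.
move=> I; apply: (noetherian_adjoin_ideal (f := i) (x := x) Cn).
move=> B Bi BD BM Bx; apply: sgen => //.
  by move=> c; rewrite -iC; apply: Bi.
move=> y; rewrite inE => /predU1P[->|]; first by apply: Bx; rewrite mem_head.
by rewrite -tE => /mapP[c _ ->]; apply: Bi.
Qed.

Lemma ideal_gen_cons (R : comPzRingType) (x : R) (s : seq R) (y : R) :
  ideal_gen [set z | z \in x :: s] y ->
  exists r b, y = r * x + b /\ ideal_gen [set z | z \in s] b.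
Proof.
have [G0 GD GM] := ideal_gen_ideal [set z | z \in s].
have JI : is_ideal [set y | exists r b,
    y = r * x + b /\ ideal_gen [set z | z \in s] b].
  split=> [|_ _ [r [b [-> sb]]] [q [c [-> sc]]]|a _ [r [b [-> sb]]]].
  - by exists 0, 0; rewrite mul0r addr0.
  - by exists (r + q), (b + c); split; [ring|apply: GD].
  - by exists (a * r), (a * b); split; [ring|apply: GM].
move=> /(_ (Ideal JI)); apply=> z; rewrite /= inE => /predU1P[->|zs].
  by exists 1, 0; rewrite mul1r addr0.
by exists 0, z; rewrite mul0r add0r; split=> //; apply: sub_ideal_gen.
Qed.

(** If products of n elements of (s) vanish, then a product of n elements of (x, s) is a multiple of
    x; hence one of p * n elements is a multiple of x ^+ p, which is 0 for suitable p. *)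
Lemma ideal_gen_nilpotent (R : comPzRingType) (s : seq R) :
  (forall x, x \in s -> exists n, x ^+ n = 0) ->
  exists n, forall a : seq R, size a = n ->
    (forall y, y \in a -> ideal_gen [set x | x \in s] y) ->
    \prod_(y <- a) y = 0.
Proof.
elim: s => [_|x s IH snil].
  (* The exponent for the zero ideal is 1, not 0, because the empty product is 1. *)
  exists 1%N => -[|y []] // _ /(_ y (mem_head _ _)) y0.
  rewrite big_seq1; have I0 : is_ideal [set 0 : R].
    by split=> [//|_ _ -> ->|b _ ->]; rewrite ?addr0 ?mulr0.
  by apply: (y0 (Ideal I0)).
have [n nP] := IH (fun y ys => snil y (@mem_behead _ (x :: s) y ys)).
have [p xp] := snil x (mem_head _ _).
have n_prod (a : seq R) : size a = n ->
    (forall y, y \in a -> ideal_gen [set z | z \in x :: s] y) ->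
    exists r, \prod_(y <- a) y = r * x.
  move=> an ax; have [b [bn bs [r ->]]] : exists b : seq R,
      [/\ size b = size a, forall y, y \in b -> ideal_gen [set z | z \in s] y
        & exists r, \prod_(y <- a) y = r * x + \prod_(y <- b) y].
    elim: a {an} ax => [|y a IHa] ax.
      by exists [::]; split=> //; exists 0; rewrite !big_nil mul0r add0r.
    have [b [bn bs [r rE]]] := IHa (fun z za => ax z (@mem_behead _ (y :: a) z za)).
    have [q [c [yE sc]]] := ideal_gen_cons (ax y (mem_head _ _)).
    exists (c :: b); split=> [/=|z|]; first by rewrite bn.
      by rewrite inE => /predU1P[->//|/bs].
    exists (q * r * x + q * \prod_(z <- b) z + c * r).
    by rewrite !big_cons rE yE; ring.
  by exists r; rewrite nP ?addr0 // bn.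
exists (p * n)%N => a an ax.
suff [r ->] : exists r, \prod_(y <- a) y = r * x ^+ p by rewrite xp mulr0.
elim: p {xp} a an ax => [|p IHp] a an ax.
  by exists (\prod_(y <- a) y); rewrite mulr1.
rewrite -(cat_take_drop n a) big_cat.
have [|y /mem_take|r ->] := n_prod (take n a); last 1 first.
- have [|y /mem_drop|q ->] := IHp (drop n a); last 1 first.
  + by exists (r * q); rewrite exprS /=; ring.
  + by rewrite size_drop an mulSn addKn.
  + exact: ax.
- by rewrite size_takel // an mulSn leq_addr.
- exact: ax.
Qed.

Lemma noetherian_nilradical (R : comPzRingType) :
  noetherian_ring R -> nilpotent_ideal (nilradical R).
Proof.
move=> /(_ (nilradical R))[s sP]; have snil x : x \in s -> exists n, x ^+ n = 0.
  move=> xs; rewrite -[exists n, _]/((nilradical R : set R) x) [X in X x]sP.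
  exact: sub_ideal_gen.
have [n nP] := ideal_gen_nilpotent snil; exists n => a aN.
rewrite -(big_map a xpredT id); apply: nP.
  by rewrite size_map -[RHS](size_enum_ord n) /index_enum -enumT.
move=> _ /mapP[i _ ->]; have : (nilradical R : set R) (a i) by apply: aN.
by rewrite [X in X _]sP.
Qed.

Lemma fgalg_nilradical (k : fieldType) (A : fgalg k) :
  nilpotent_ideal (nilradical A).
Proof.
have [s sgen] := alg_fg A.
exact: noetherian_nilradical (noetherian_alg_generated (@noetherian_field k) sgen).
Qed.

(** * Points and lifting problems *)

Section Yoneda.
Variables (C : category) (a : C) (F : setfunctor C).

Fact yoneda_natural (x : F a) (b c : C) (f : arr b c) (g : corep a b) :
  fmap F (fmap (corep a) f g) x = fmap F f (fmap F g x).
Proof. exact: fmapM. Qed.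

Definition yoneda (x : F a) : nattrans (corep a) F :=
  @NatTrans C (corep a) F (fun b g => fmap F g x) (yoneda_natural x).

Lemma yonedaE (x : F a) : yoneda x a (arr_id a) = x.
Proof. exact: fmap1. Qed.

Lemma yoneda_inj (u v : nattrans (corep a) F) :
  u a (arr_id a) = v a (arr_id a) -> u = v.
Proof.
move=> uv; apply: nattrans_eq => b g.
by rewrite -[g]compm1 -[arr_comp _ _]/(fmap (corep a) g (arr_id a))
  !nat_natural uv.
Qed.

End Yoneda.

(** One direction tests the universal property on corepresentable functors. In the other, the
    pointwise solutions are chosen, and their uniqueness makes them natural. *)
Lemma is_pullback_pointwise (C : category) (P A B D : setfunctor C)
    (p : nattrans P A) (q : nattrans P B)
    (a : nattrans A D) (b : nattrans B D) :
  is_pullback p q a b <->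
  (forall c (z : P c), a c (p c z) = b c (q c z)) /\
  forall c (x : A c) (y : B c), a c x = b c y ->
    exists! z : P c, p c z = x /\ q c z = y.
Proof.
split=> [[comm univ]|[comm univ]]; split.
- by move=> c z; apply: (congr1 (fun u : nattrans P D => u c z) comm).
- move=> c x y xy.
  have [|w [[wp wq] wuniq]] := univ (corep c) (yoneda x) (yoneda y).
    by apply: yoneda_inj; rewrite /= !fmap1.
  exists (w c (arr_id c)); split.
    by split; [rewrite -[RHS]yonedaE -wp|rewrite -[RHS]yonedaE -wq].
  move=> z [zx zy].
  have /wuniq -> : nat_comp p (yoneda z) = yoneda x /\
                   nat_comp q (yoneda z) = yoneda y.
    by split; apply: yoneda_inj; rewrite /= !fmap1.
  exact: yonedaE.
- by apply: nattrans_eq => c z; apply: comm.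
- move=> Z u v uv.
  have uvE c (z : Z c) : a c (u c z) = b c (v c z).
    exact: (congr1 (fun t : nattrans Z D => t c z) uv).
  pose w c (z : Z c) := projT1 (cid (univ c _ _ (uvE c z))).
  have wP c z : p c (w c z) = u c z /\ q c (w c z) = v c z.
    by rewrite /w; case: cid => ? [].
  have w_uniq c (z : Z c) t : p c t = u c z -> q c t = v c z -> w c z = t.
    by rewrite /w; case: cid => s [_ sP] /= pt qt; apply: sP.
  have wN c d (g : arr c d) (z : Z c) : w d (fmap Z g z) = fmap P g (w c z).
    by apply: w_uniq; rewrite !nat_natural; case: (wP c z) => pw qw; congr fmap.
  exists (NatTrans wN); split.
    by split; apply: nattrans_eq => c z; case: (wP c z).
  move=> t [tu tv]; apply: nattrans_eq => c z /=.
  by apply: w_uniq; rewrite -?tu -?tv.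
Qed.

Lemma factor_surjective (R S T : comPzRingType) (p : {rmorphism R -> S})
    (g : {rmorphism R -> T}) :
  (forall y, exists x, y = p x) -> (forall x, p x = 0 -> g x = 0) ->
  exists h : {rmorphism S -> T}, rcomp h p = g.
Proof.
move=> psurj pg; pose s y := projT1 (cid (psurj y)); pose h y := g (s y).
have hE x : h (p x) = g x.
  apply/eqP; rewrite -subr_eq0 -rmorphB; apply/eqP/pg.
  by rewrite rmorphB /s; case: cid => z /= <-; rewrite subrr.
have hB : zmod_morphism h.
  move=> x y; have [x' ->] := psurj x; have [y' ->] := psurj y.
  by rewrite -rmorphB !hE rmorphB.
have hM : monoid_morphism h.
  split=> [|x y]; first by rewrite -(rmorph1 p) hE rmorph1.
  have [x' ->] := psurj x; have [y' ->] := psurj y.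
  by rewrite -rmorphM !hE rmorphM.
pose hA := GRing.isZmodMorphism.Build S T h hB.
pose hR := GRing.isMonoidMorphism.Build S T h hM.
exists (HB.pack_for {rmorphism S -> T} h hA hR).
exact: rmorphism_eq.
Qed.

Lemma seq_preimage (T U : eqType) (f : T -> U) (s : seq U) :
  (forall y, exists x, y = f x) -> exists t, map f t = s.
Proof.
move=> fsurj; elim: s => [|y s [t <-]]; first by exists [::].
by have [x ->] := fsurj y; exists (x :: t).
Qed.

(** * Reduction modulo the nilradical *)

Definition Red (R : comPzRingType) : comPzRingType := quot (nilradical R).
Definition redp (R : comPzRingType) : {rmorphism R -> Red R} :=
  qproj (nilradical R).
Definition redm (R S : comPzRingType) (f : {rmorphism R -> S}) :
  {rmorphism Red R -> Red S} := qmap (@nilradical_map _ _ f).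

Lemma redmE (R S : comPzRingType) (f : {rmorphism R -> S}) x :
  redm f (redp R x) = redp S (f x).
Proof. exact: qmapE. Qed.

Lemma redp_surj (R : comPzRingType) (y : Red R) : exists x, y = redp R x.
Proof. exact: qproj_surj. Qed.

Lemma redp_eq0 (R : comPzRingType) (x : R) :
  redp R x = 0 <-> exists n, x ^+ n = 0.
Proof. by rewrite -(rmorph0 (redp R)) qproj_eq subr0. Qed.

Lemma redp_comp (R S : comPzRingType) (f : {rmorphism R -> S}) :
  rcomp (redm f) (redp R) = rcomp (redp S) f.
Proof. by apply: rmorphism_eq => x; apply: redmE. Qed.

Lemma redm_comp (R S T : comPzRingType) (g : {rmorphism S -> T})
  (f : {rmorphism R -> S}) : redm (rcomp g f) = rcomp (redm g) (redm f).
Proof.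
apply: rmorphism_eq => y; have [x ->] := redp_surj y.
by rewrite redmE -[RHS]/(redm g (redm f (redp R x))) !redmE.
Qed.

(** An element of R with nilpotent image in S is nilpotent. This lets points over [Red R] descend to
    [Red C] for a subring C of R. *)
Lemma redm_inj (R S : comPzRingType) (f : {rmorphism R -> S}) :
  injective f -> injective (redm f).
Proof.
move=> f_inj x y xy; apply/eqP; rewrite -subr_eq0; apply/eqP.
have : redm f (x - y) = 0 by rewrite rmorphB xy subrr.
have [z ->] := redp_surj (x - y); rewrite redmE => /redp_eq0[n fz].
by apply/redp_eq0; exists n; apply: f_inj; rewrite rmorphXn rmorph0.
Qed.

Lemma redm_localization (R S : comPzRingType) (h : R) (l : {rmorphism R -> S}) :
  is_localization h l -> is_localization (redp R h) (redm l).
Proof.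
case=> [[u lhu] lfrac lker]; split.
- by exists (redp S u); rewrite redmE -rmorphM lhu rmorph1.
- move=> s'; have [s ->] := redp_surj s'; have [r [n srn]] := lfrac s.
  by exists (redp R r), n; rewrite redmE -rmorphXn -rmorphM srn redmE.
- move=> r'; have [r ->] := redp_surj r'; rewrite redmE => /redp_eq0[m].
  rewrite -rmorphXn => /lker[n hr]; exists 1%N; rewrite expr1 -rmorphM.
  apply/redp_eq0; exists (n + m)%N.
  have -> : (h * r) ^+ (n + m) = (h ^+ n * r ^+ m) * (h ^+ m * r ^+ n).
    by rewrite exprMn !exprD; ring.
  by rewrite hr mul0r.
Qed.

Lemma unit_ideal_redp (R : comPzRingType) (E : set R) :
  unit_ideal (redp R @` E) -> unit_ideal E.
Proof.
move=> E1 J EJ; have JI : is_ideal [set y | exists2 x, J x & redp R x = y].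
  split=> [|_ _ [x Jx <-] [z Jz <-]|y' _ [x Jx <-]].
  - by exists 0; [apply: ideal0|rewrite rmorph0].
  - by exists (x + z); [apply: idealD|rewrite rmorphD].
  - have [y ->] := redp_surj y'.
    by exists (y * x); [apply: idealMl|rewrite rmorphM].
have [|x Jx x1] := E1 (Ideal JI).
  by move=> _ [x Ex <-]; exists x => //; apply: EJ.
have /redp_eq0[n xn] : redp R (1 - x) = 0 by rewrite rmorphB x1 rmorph1 subrr.
(* Geometric series in the nilpotent element 1 - x. *)
have -> : 1 = (\sum_(i < n) (1 - x) ^+ i) * x + (1 - x) ^+ n :> R.
  have := subrX1 (1 - x) n; rewrite (_ : 1 - x - 1 = - x); last by ring.
  by move=> e; rewrite -[(1 - x) ^+ n](subrK 1) e; ring.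
by rewrite xn addr0; apply: idealMl.
Qed.

Definition pull (X : setfunctor CRing) (R S : comPzRingType)
  (f : {rmorphism R -> S}) : X R -> X S := fmap X (f : arr (R : CRing) S).

Lemma pull_id (X : setfunctor CRing) (R : comPzRingType) (x : X R) :
  pull (rid R) x = x.
Proof. exact: (fmap1 (s := X)). Qed.

Lemma pull_comp (X : setfunctor CRing) (R S T : comPzRingType)
    (g : {rmorphism S -> T}) (f : {rmorphism R -> S}) (x : X R) :
  pull (rcomp g f) x = pull g (pull f x).
Proof. exact: (fmapM (s := X)). Qed.

Lemma pull_nat (X Y : setfunctor CRing) (f : nattrans X Y)
    (R S : comPzRingType) (g : {rmorphism R -> S}) (x : X R) :
  f S (pull g x) = pull g (f R x).
Proof. exact: nat_natural. Qed.

Lemma Spec_point (A : comPzRingType) (X : setfunctor CRing)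
    (j : nattrans (Spec A) X) (R : comPzRingType) (a : {rmorphism A -> R}) :
  j R a = pull a (j A (rid A)).
Proof.
by rewrite -pull_nat; congr (j R _); apply: rmorphism_eq.
Qed.

(** Bijectivity of X(R) -> X(S) x_Y(S) Y(R). *)
Definition unique_lifting (X Y : setfunctor CRing) (f : nattrans X Y)
    (R S : comPzRingType) (p : {rmorphism R -> S}) : Prop :=
  forall (u : X S) (v : Y R), f S u = pull p v ->
    exists! w : X R, pull p w = u /\ f R w = v.

Lemma formally_etaleP (X Y : scheme) (f : nattrans X Y) :
  formally_etale f <->
  forall (R : comPzRingType) (N : ideal R), nilpotent_ideal N ->
    unique_lifting f (qproj N).
Proof.
split=> H R N Nnil u v /=.
  move=> uv.
  have [|w [[wu wv] wuniq]] := H R N Nnil (yoneda (u : X (quot N : CRing)))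
      (yoneda (v : Y (R : CRing))).
    apply: yoneda_inj; rewrite /= fmap1.
    by apply: etrans uv _; congr (fmap Y _ v); apply: rmorphism_eq.
  exists (w R (rid R)); split.
    split.
      rewrite -[RHS](yonedaE (u : X (quot N : CRing))) -wu /=.
      rewrite -pull_nat; congr (w _ _); exact: rmorphism_eq.
    by rewrite -[RHS](yonedaE (v : Y (R : CRing))) -wv.
  move=> z [zu zv].
  have /wuniq -> : nat_comp (yoneda (z : X (R : CRing)))
      (corep_map (qproj N : arr (R : CRing) (quot N : CRing)))
        = yoneda (u : X (quot N : CRing)) /\
      nat_comp f (yoneda (z : X (R : CRing))) = yoneda (v : Y (R : CRing)).
    split; apply: yoneda_inj; rewrite /= !fmap1 //.
    by rewrite -[LHS]/(pull _ z) -zu; congr (pull _ z); apply: rmorphism_eq.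
  exact: (yonedaE (z : X (R : CRing))).
move=> uv.
have [|w [[wu wv] wuniq]] := H R N Nnil (u _ (rid _)) (v _ (rid _)).
  rewrite -[LHS]/((nat_comp f u) _ (rid _)) uv /= -pull_nat.
  by congr (v _ _); apply: rmorphism_eq.
exists (yoneda (w : X (R : CRing))); split.
  split; apply: yoneda_inj; rewrite /= ?fmap1 //.
  by rewrite -wu; congr (pull _ w); apply: rmorphism_eq.
move=> z [zu zv]; apply: yoneda_inj; rewrite /= fmap1; apply: wuniq.
rewrite -zu -zv; split=> //=.
by rewrite -pull_nat; congr (z _ _); apply: rmorphism_eq.
Qed.

(** * Lifting along reductions *)

(** As N consists of nilpotents, [redp R] factors as R -> R/N -> [Red R]. The pair given by v and
    the image of u over [Red R] has a lift w; over R/N, both w and u lift the same data along the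
    reduction of R/N, so they agree there. *)
Lemma unique_lifting_of_red (X Y : setfunctor CRing) (f : nattrans X Y)
    (R : comPzRingType) (N : ideal R) :
  (forall x, N x -> nilradical R x) ->
  unique_lifting f (redp R) -> unique_lifting f (redp (quot N)) ->
  unique_lifting f (qproj N).
Proof.
move=> Nnil HR HRN u v uv; set p := qproj N in uv *.
have [t tp] : exists t : {rmorphism quot N -> Red R}, rcomp t p = redp R.
  apply: factor_surjective; first exact: qproj_surj.
  move=> x /(qproj_eq N x 0); rewrite subr0 => /Nnil xn.
  by apply/(qproj_eq (nilradical R) x 0); rewrite subr0.
have pt : rcomp (redm p) t = redp (quot N).
  apply: rmorphism_eq => y; have [x ->] := qproj_surj y.
  by rewrite -[LHS]/(redm p (rcomp t p x)) tp redmE.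
have [|w [[wu wv] wuniq]] := HR (pull t u) v.
  by rewrite pull_nat uv -pull_comp tp.
have fw : f _ (pull p w) = pull p v by rewrite pull_nat wv.
exists w; split.
  split=> //; have [|z [_ zuniq]] := HRN (pull (redp (quot N)) u) (pull p v).
    by rewrite pull_nat uv.
  rewrite -(zuniq (pull p w)); last first.
    by split=> //; rewrite -pull_comp -redp_comp pull_comp wu -pull_comp pt.
  by apply: zuniq.
by move=> z [zu zv]; apply: wuniq; rewrite -zu -pull_comp tp.
Qed.

Lemma range_pull (U X : setfunctor CRing) (j : nattrans U X)
    (R S : comPzRingType) (g : {rmorphism R -> S}) (x : X R) :
  range (j R) x -> range (j S) (pull g x).
Proof. by case=> y _ <-; exists (pull g y) => //; rewrite pull_nat. Qed.

(** Spec R and Spec of its reduction have the same open sets: an ideal is the unit ideal as soon as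
    its image modulo nilpotents is. *)
Lemma open_red (X : setfunctor CRing) (U : forall R : CRing, set (X R)) :
  open_subfunctor U -> forall (R : comPzRingType) (x : X R),
  U (Red R) (pull (redp R) x) -> U R x.
Proof.
move=> Uo R x; have [I IP] := Uo R x.
move/IP/unit_ideal_redp => I1; rewrite -(pull_id x); apply/IP.
exact: (@unit_ideal_image _ _ (rid R)) I1.
Qed.

(* Membership in an open subfunctor amounts to an equation 1 = sum r_i a(e_i), *)
(* and t lists the coefficients r_i.                                           *)
Lemma open_finite_witness (X : setfunctor CRing)
    (U : forall R : CRing, set (X R)) (A : comPzRingType) (y : X A)
    (R : comPzRingType) (a : {rmorphism A -> R}) :
  open_subfunctor U -> U R (pull a y) ->
  exists t : seq R, forall (C : comPzRingType) (i : {rmorphism C -> R})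
      (b : {rmorphism A -> C}),
    injective i -> (forall x, x \in t -> exists c, i c = x) ->
    (forall x, i (b x) = a x) -> U C (pull b y).
Proof.
move=> Uo; have [I IP] := Uo A y => /IP/ideal_genP[s [sI s1]].
exists (map fst s) => C i b i_inj it ib; apply/IP => J HJ.
have sI' (p : R * R) : p \in s -> exists q : C * C,
    [/\ i q.1 = p.1, i q.2 = p.2 & J q.2].
  move=> ps; have [c cE] := it _ (map_f fst ps).
  have [x Ix xE] := sI _ ps; exists (c, b x); split=> //=; first by rewrite ib.
  by apply: HJ; exists x.
(* The whole sum has a preimage in J, which must be 1 because [i] is injective. *)
suff [z Jz z1] : exists2 z, J z & i z = \sum_(p <- s) p.1 * p.2.
  by rewrite -(i_inj z 1) // rmorph1 s1.
elim: s {sI s1 it} sI' => [_|p s IH sI'].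
  by exists 0; rewrite ?rmorph0 ?big_nil //; apply: ideal0.
have [q qs|z Jz zE] := IH; first by apply: sI'; rewrite inE qs orbT.
have [[c d] [/= cE dE Jd]] := sI' _ (mem_head _ _).
exists (c * d + z); first by apply: idealD => //; apply: idealMl.
by rewrite big_cons rmorphD rmorphM cE dE zE.
Qed.

Lemma alg_generated_image (k A S T : comPzRingType) (str : {rmorphism k -> A})
    (s : seq A) (i : {rmorphism S -> T}) (a : {rmorphism A -> T}) :
  alg_generated str s ->
  (forall c, exists y, i y = a (str c)) ->
  (forall x, x \in s -> exists y, i y = a x) ->
  forall x, exists y, i y = a x.
Proof.
move=> sgen ik is_; apply: (sgen [set x | exists y, i y = a x]) => //.
- by move=> x x' [y yE] [z zE]; exists (y + z); rewrite !rmorphD yE zE.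
- by move=> x x' [y yE] [z zE]; exists (y * z); rewrite !rmorphM yE zE.
Qed.

Lemma fg_subalgebra (k R : comPzRingType) (str : {rmorphism k -> R})
    (s : seq R) :
  exists (C : fgalg k) (i : {rmorphism C -> R}),
    [/\ injective i, forall c, i (alg_str C c) = str c
      & forall x, x \in s -> exists c, i c = x].
Proof.
have [C [strC [i [t [i_inj iC tE tgen]]]]] := subalgebra_exists str s.
exists (@FgAlg k C strC (ex_intro _ t tgen)), i; split=> //.
  by move=> c; rewrite -iC.
by move=> x; rewrite -tE => /mapP[c _ ->]; exists c.
Qed.

(** * Lifting inside affine charts *)

Section LocalLifting.
Variables (k : comPzRingType) (X Y : noeth_kscheme k) (f : kscheme_mor X Y).

Hypothesis fg_lifting : forall (C : fgalg k) (u : X (Red C)) (v : Y C),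
  kstr Y C v = alg_str C -> f (Red C) u = pull (redp C) v ->
  exists! w : X C, pull (redp C) w = u /\ f C w = v.

Variables (A B : CRing) (j : nattrans (Spec A) X) (j' : nattrans (Spec B) Y).
Hypothesis (jo : open_immersion j) (jo' : open_immersion j').
Variables (sA : seq A) (sB : seq B).
Hypothesis sA_gen : alg_generated (kstr X A (j A (rid A))) sA.
Hypothesis sB_gen : alg_generated (kstr Y B (j' B (rid B))) sB.

Let strA := kstr X A (j A (rid A)).
Let strB := kstr Y B (j' B (rid B)).

Let kstrY (R : comPzRingType) (x : X R) : kstr Y R (f R x) = kstr X R x.
Proof. by rewrite -(kmor_str f). Qed.

Let strAE (R : comPzRingType) (a : {rmorphism A -> R}) (c : k) :
  kstr X R (j R a) c = a (strA c).
Proof. by rewrite Spec_point pull_nat. Qed.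

Let strBE (R : comPzRingType) (b : {rmorphism B -> R}) (c : k) :
  kstr Y R (j' R b) c = b (strB c).
Proof. by rewrite Spec_point pull_nat. Qed.

Let str_eq (R : comPzRingType) (a : {rmorphism A -> R})
    (b : {rmorphism B -> R}) (c : k) :
  f R (j R a) = j' R b -> a (strA c) = b (strB c).
Proof. by move=> e; rewrite -strAE -strBE -e kstrY. Qed.

(** Over R the point f(j(a)) lies in the open chart B, hence so does its descent to C once C
    contains finitely many witnesses. The resulting [b''] agrees with [b'] because it does so in R,
    where [j'] is injective. *)
Let descend (R : comPzRingType) (a : {rmorphism A -> R})
    (b : {rmorphism B -> R}) :
  f R (j R a) = j' R b ->
  exists t : seq R, forall (C : comPzRingType) (i : {rmorphism C -> R})
      (a' : {rmorphism A -> C}) (b' : {rmorphism B -> C}),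
    injective i -> (forall x, x \in t -> exists c, i c = x) ->
    (forall x, i (a' x) = a x) -> (forall x, i (b' x) = b x) ->
    f C (j C a') = j' C b'.
Proof.
move=> e; have [jinj' jopen'] := jo'.
have fj (S : comPzRingType) (g : {rmorphism A -> S}) :
    f S (j S g) = pull g (f A (j A (rid A))).
  by rewrite Spec_point pull_nat.
have [|t tP] := @open_finite_witness Y _ A (f A (j A (rid A))) R a jopen'.
  by rewrite -fj e; exists b.
exists t => C i a' b' i_inj it ia ib.
have [b'' _ b''E] := tP C i a' i_inj it ia.
rewrite fj -b''E; congr (j' C _); apply: rmorphism_eq => x; apply: i_inj.
rewrite ib -[LHS]/(rcomp i b'' x); congr ((_ : {rmorphism _ -> _}) x).
apply: jinj'; rewrite -e fj -[LHS]/(j' R (pull i (b'' : Spec B C))) pull_nat b''E.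
by rewrite -pull_comp; congr (pull _ _); apply: rmorphism_eq.
Qed.

Lemma local_lift_exists (R : comPzRingType) (u : X (Red R)) (v : Y R) :
  f (Red R) u = pull (redp R) v -> range (j (Red R)) u -> range (j' R) v ->
  exists w : X R, pull (redp R) w = u /\ f R w = v.
Proof.
move=> e uU vV; case: uU e => a _ <-; case: vV => b _ <-; rewrite -pull_nat => e.
have [t tP] := descend e.
(* R is a k-algebra through [b]. The subalgebra C contains the image of B, and, by including lifts
   [t'] to R, [Red C] contains the image of A and the witnesses for the equation over [Red R]. *)
have [t' t'E] := seq_preimage (map a sA ++ t) (@redp_surj R).
have [C [i [i_inj iC it]]] := fg_subalgebra (rcomp b strB) (map b sB ++ t').
have it' y : y \in map a sA ++ t -> exists c, redm i c = y.
  rewrite -t'E => /mapP[x xt ->].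
  have [|c <-] := it x; first by rewrite mem_cat xt orbT.
  by exists (redp C c); rewrite redmE.
have [b' b'E] : exists b' : {rmorphism B -> C}, forall x, i (b' x) = b x.
  apply: factor_injective => //; apply: (alg_generated_image sB_gen).
    by move=> c; exists (alg_str C c); rewrite iC.
  by move=> x xs; apply: it; rewrite mem_cat map_f.
have [a' a'E] : exists a' : {rmorphism A -> Red C},
    forall x, redm i (a' x) = a x.
  apply: factor_injective; first exact: redm_inj.
  apply: (alg_generated_image sA_gen) => [c|x xs].
    exists (redp C (alg_str C c)); rewrite redmE iC.
    by rewrite (str_eq _ e).
  by apply: it'; rewrite mem_cat map_f.
have [||w [[wu wv] _]] := @fg_lifting C (j (Red C) a') (j' C b').
- apply: rmorphism_eq => c; apply: i_inj; rewrite strBE b'E iC.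
  by [].
- rewrite -pull_nat; apply: (tP _ (redm i)).
  + exact: redm_inj.
  + by move=> y yt; apply: it'; rewrite mem_cat yt orbT.
  + exact: a'E.
  + by move=> x; rewrite [LHS]redmE b'E.
exists (pull i w); split; last first.
  by rewrite pull_nat wv -pull_nat; congr (j' R _); apply: rmorphism_eq.
rewrite -pull_comp -redp_comp pull_comp wu -pull_nat.
by congr (j _ _); apply: rmorphism_eq.
Qed.

Lemma local_lift_unique (R : comPzRingType) (v : Y R) (w1 w2 : X R) :
  range (j (Red R)) (pull (redp R) w1) -> range (j' R) v ->
  pull (redp R) w1 = pull (redp R) w2 -> f R w1 = v -> f R w2 = v -> w1 = w2.
Proof.
have [jinj jopen] := jo.
move=> w1U vV w12; have w2U := w1U; rewrite w12 in w2U.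
(* Both lifts lie in the chart A since their common reduction does; C is then taken large enough for
   both of them and both equations. *)
have [a1 _ w1E] := open_red jopen w1U; have [a2 _ w2E] := open_red jopen w2U.
have [b _ <-] := vV; move: w12; rewrite -w1E -w2E => w12 e1 e2.
have [t1 t1P] := descend e1; have [t2 t2P] := descend e2.
have [C [i [i_inj iC it]]] := fg_subalgebra (rcomp b strB)
  (map b sB ++ (map a1 sA ++ map a2 sA) ++ (t1 ++ t2)).
have [b' b'E] : exists b' : {rmorphism B -> C}, forall x, i (b' x) = b x.
  apply: factor_injective => //; apply: (alg_generated_image sB_gen).
    by move=> c; exists (alg_str C c); rewrite iC.
  by move=> x xs; apply: it; rewrite mem_cat map_f.
have aE (a : {rmorphism A -> R}) : f R (j R a) = j' R b ->
    {subset map a sA <= map a1 sA ++ map a2 sA} ->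
    exists a' : {rmorphism A -> C}, forall x, i (a' x) = a x.
  move=> e sub; apply: factor_injective => //.
  apply: (alg_generated_image sA_gen) => [c|x xs].
    by exists (alg_str C c); rewrite iC (str_eq _ e).
  by apply: it; rewrite mem_cat mem_cat sub ?orbT // map_f.
have [|a1' a1E] := aE _ e1; first by move=> x xs; rewrite mem_cat xs.
have [|a2' a2E] := aE _ e2; first by move=> x xs; rewrite mem_cat xs orbT.
have e1' : f C (j C a1') = j' C b'.
  apply: (t1P _ i) => // x xt; apply: it.
  by rewrite !mem_cat xt !orbT.
have e2' : f C (j C a2') = j' C b'.
  apply: (t2P _ i) => // x xt; apply: it.
  by rewrite !mem_cat xt !orbT.
(* The two points agree over [Red R], and [Red C] embeds there. *)
have red_eq : rcomp (redp C) a1' = rcomp (redp C) a2'.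
  have /jinj r12 : j (Red R) (rcomp (redp R) a1) = j (Red R) (rcomp (redp R) a2).
    by move: w12; rewrite -!pull_nat.
  apply: rmorphism_eq => x; apply: (redm_inj i_inj).
  rewrite /= !redmE a1E a2E.
  exact: (congr1 (fun g : {rmorphism A -> Red R} => g x) r12).
have [||w [_ wuniq]] :=
    @fg_lifting C (j (Red C) (rcomp (redp C) a1')) (j' C b').
- apply: rmorphism_eq => c; apply: i_inj; rewrite strBE b'E iC.
  by [].
- by rewrite -e1' -pull_nat -pull_nat.
have jC : j C a1' = j C a2'.
  transitivity w; [apply/esym|]; apply: wuniq; rewrite -pull_nat //.
  by rewrite red_eq.
have jR (a : {rmorphism A -> R}) (a' : {rmorphism A -> C}) :
    (forall x, i (a' x) = a x) -> j R a = pull i (j C a').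
  by move=> aE'; rewrite -pull_nat; congr (j R _); apply: rmorphism_eq => x; rewrite -aE'.
by rewrite (jR _ _ a1E) (jR _ _ a2E) jC.
Qed.

End LocalLifting.

(** * Gluing the local lifts *)

Lemma red_to_field (R : comPzRingType) (K : fieldType) (f : {rmorphism R -> K}) :
  exists g : {rmorphism Red R -> K}, rcomp g (redp R) = f.
Proof.
apply: factor_surjective; first exact: redp_surj.
move=> x /redp_eq0[n xn]; apply/eqP.
have : f x ^+ n == 0 by rewrite -rmorphXn xn rmorph0.
by rewrite expf_eq0 => /andP[].
Qed.

Lemma unit_ideal_nonzero (R : comPzRingType) (K : fieldType)
    (f : {rmorphism R -> K}) (E : set R) :
  unit_ideal (f @` E) -> exists2 x, E x & f x != 0.
Proof.
move=> E1; apply: contrapT => E0.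
have I0 : is_ideal [set 0 : K].
  by split=> [//|_ _ -> ->|b _ ->]; rewrite ?addr0 ?mulr0.
suff /eqP : (1 : K) = 0 by rewrite oner_eq0.
apply: (E1 (Ideal I0)) => _ [x Ex <-] /=; apply: contrapT => /eqP fx.
by apply: E0; exists x.
Qed.

Section GlobalLifting.
Variables (k : comPzRingType) (X Y : noeth_kscheme k) (f : kscheme_mor X Y).

Hypothesis fg_lifting : forall (C : fgalg k) (u : X (Red C)) (v : Y C),
  kstr Y C v = alg_str C -> f (Red C) u = pull (redp C) v ->
  exists! w : X C, pull (redp C) w = u /\ f C w = v.

Lemma unique_lifting_redp (R : comPzRingType) : unique_lifting f (redp R).
Proof.
move=> u v uv.
have [I [A [j [[jo jcov] jfg]]]] := kcover X.
have [I' [B [j' [[jo' jcov'] jfg']]]] := kcover Y.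
(* [good] maps are those over which u and v each lie in a single chart, so that local lifting
   applies. *)
pose good (S : comPzRingType) (l : {rmorphism R -> S}) := exists i i',
  range (j i (Red S)) (pull (redm l) u) /\ range (j' i' S) (pull l v).
have good_comp (S T : comPzRingType) (l : {rmorphism R -> S})
    (g : {rmorphism S -> T}) : good S l -> good T (rcomp g l).
  case=> i [i' [ui vi']]; exists i, i'; rewrite redm_comp !pull_comp.
  by split; apply: range_pull.
have good_uniq (S : comPzRingType) (l : {rmorphism R -> S}) (w1 w2 : X S) :
    good S l -> pull (redp S) w1 = pull (redm l) u -> f S w1 = pull l v ->
    pull (redp S) w2 = pull (redm l) u -> f S w2 = pull l v -> w1 = w2.
  case=> i [i' [ui vi']] w1u w1v w2u w2v.
  have [sA sAgen] := jfg i; have [sB sBgen] := jfg' i'.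
  apply: (local_lift_unique fg_lifting (jo i) (jo' i') sAgen sBgen _ vi') => //.
    by rewrite w1u.
  by rewrite w1u w2u.
have good_ex (S : comPzRingType) (l : {rmorphism R -> S}) : good S l ->
    exists w, pull (redp S) w = pull (redm l) u /\ f S w = pull l v.
  case=> i [i' [ui vi']].
  have [sA sAgen] := jfg i; have [sB sBgen] := jfg' i'.
  apply: (local_lift_exists fg_lifting (jo' i') sAgen sBgen _ ui vi').
  by rewrite pull_nat uv -!pull_comp redp_comp.
have /unit_ideal_finite[n [h [h_good h1]]] :
    unit_ideal [set h | good (localization h) (loc_map h)].
  (* At a field-valued point q, u and v lie in charts, whose preimages are D(J) and D(J'). Elements
     of J and J' that are nonzero at q are multiplied, after lifting the first to R, and inverting
     the product gives a good localization. *)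
  apply: unit_ideal_field => K q; have [q' q'E] := red_to_field q.
  have [i ui] := jcov K (pull q' u); have [i' vi'] := jcov' K (pull q v).
  have [J JP] := (jo i).2 (Red R) u; have [J' J'P] := (jo' i').2 R v.
  have [x' Jx' q'x] := unit_ideal_nonzero ((JP _ _).1 ui).
  have [x'' J'x qx''] := unit_ideal_nonzero ((J'P _ _).1 vi').
  have [x xE] := redp_surj x'.
  exists (x * x''); last first.
    rewrite rmorphM mulf_neq0 //; move: q'x; rewrite xE -q'E.
    by [].
  have [[y yE] _ _] := loc_mapP (x * x''); set l := loc_map _ in yE *.
  exists i, i'; split.
    apply/JP; apply: (unit_ideal_unit (x := redp _ (l x)) (y := redp _ (l x'' * y))).
      by exists x' => //; rewrite xE redmE.
    by rewrite -rmorphM mulrA -rmorphM yE rmorph1.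
  apply/J'P; apply: (unit_ideal_unit (x := l x'') (y := l x * y)).
    by exists x''.
  by rewrite mulrCA mulrA -rmorphM yE.
pose S i := localization (h i).
pose l i : {rmorphism R -> S i} := loc_map (h i).
have lP i : is_localization (h i) (l i) := loc_mapP (h i).
pose w i : X (S i) := projT1 (cid (good_ex _ _ (h_good i))).
have wP i : pull (redp (S i)) (w i) = pull (redm (l i)) u /\
    f (S i) (w i) = pull (l i) v by rewrite /w; case: cid.
(* The local lifts are compatible since goodness passes to T, where lifts are unique. *)
have [|y [yw _]] := sch_sheaf h1 lP (x := w).
  move=> i i' T a b ab; apply: (good_uniq T (rcomp a (l i))).
  - exact/good_comp/h_good.
  - rewrite -/(pull a (w i)) -pull_comp -redp_comp pull_comp (wP i).1.
    by rewrite redm_comp pull_comp.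
  - by rewrite -/(pull a (w i)) pull_nat (wP i).2 pull_comp.
  - rewrite -/(pull b (w i')) -pull_comp -redp_comp pull_comp (wP i').1.
    by rewrite ab redm_comp pull_comp.
  - by rewrite -/(pull b (w i')) pull_nat (wP i').2 ab pull_comp.
(* The uniqueness half of the sheaf condition, stated for any scheme because it is used for X over R
   and over [Red R], and for Y over R. *)
have glue_eq (Z : scheme) (T : comPzRingType) (g : 'I_n -> T)
    (S' : 'I_n -> comPzRingType) (m : forall i, {rmorphism T -> S' i})
    (z1 z2 : Z T) : unit_ideal (range g) ->
    (forall i, is_localization (g i) (m i)) ->
    (forall i, pull (m i) z1 = pull (m i) z2) -> z1 = z2.
  move=> g1 mP z12.
  have [|z [_ zuniq]] := sch_sheaf g1 mP (x := fun i => pull (m i) z1).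
    by move=> i i' U a b ab; rewrite -/(pull a _) -/(pull b _) -!pull_comp ab.
  by rewrite -(zuniq z1) // -(zuniq z2).
exists y; split.
  split.
    apply: (glue_eq X (Red R) (fun i => redp R (h i)) (fun i => Red (S i))
      (fun i => redm (l i))) => [|i|i].
    - by have := unit_ideal_image (f := redp R) h1; rewrite image_comp.
    - exact: (redm_localization (lP i)).
    - by rewrite -(wP i).1 -(yw i) -!pull_comp redp_comp pull_comp.
  apply: (glue_eq Y R h S l) => // i.
  by rewrite -pull_nat -(wP i).2 -(yw i).
move=> z [zu zv]; apply: (glue_eq X R h S l) => // i.
apply: (good_uniq _ (l i)); first exact: h_good.
- by rewrite [pull (l i) y](yw i) (wP i).1.
- by rewrite [pull (l i) y](yw i) (wP i).2.
- by rewrite -pull_comp -redp_comp pull_comp zu.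
- by rewrite pull_nat zv.
Qed.

End GlobalLifting.

(** * The equivalence *)

Theorem mainTheorem7 (k : fieldType) (X Y : noeth_kscheme k)
    (f : kscheme_mor X Y) :
  formally_etale f <->
  is_pullback (kpoints_map f) (Im_unit (kpoints X))
              (Im_unit (kpoints Y)) (Im_map (kpoints_map f)).
Proof.
have kstrY (R : comPzRingType) (x : X R) : kstr Y R (f R x) = kstr X R x.
  by rewrite -(kmor_str f).
apply: (iff_trans (formally_etaleP _)).
apply: (iff_trans _ (iff_sym (is_pullback_pointwise _ _ _ _))).
split=> [fe|[_ pb] R N [n Nn]].
  split=> [A x|A y x xy].
    by apply: eq_exist; apply/esym/(pull_nat f (redp A)).
  case: x y xy => u uk [v vk] /(congr1 sval) /= uv.
  have [w [[wu wv] wuniq]] := fe A _ (fgalg_nilradical A) u v (esym uv).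
  (* A lift of a k-point of Y is itself a k-point, because f is a morphism over k. *)
  have wk : kstr X A w = alg_str A by rewrite -kstrY wv.
  exists (exist _ w wk); split; first by split; apply: eq_exist.
  case=> z zk [/(congr1 sval) /= zv /(congr1 sval) /= zu].
  by apply: eq_exist; apply: wuniq.
have fg_lifting (C : fgalg k) (u : X (Red C)) (v : Y C) :
    kstr Y C v = alg_str C -> f (Red C) u = pull (redp C) v ->
    exists! w : X C, pull (redp C) w = u /\ f C w = v.
  move=> vk uv.
  have uk : kstr X (Red C) u = alg_str (alg_red C).
    by rewrite -kstrY uv pull_nat vk.
  have [|[w wk] [[/(congr1 sval) /= wv /(congr1 sval) /= wu] wuniq]] :=
    pb C (exist _ v vk) (exist _ u uk).
    by apply: eq_exist; apply/esym.
  exists w; split=> // z [zu zv].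
  have zk : kstr X C z = alg_str C by rewrite -kstrY zv.
  by have /(congr1 sval) := wuniq (exist _ z zk)
    (conj (eq_exist _ _ zv) (eq_exist _ _ zu)).
(* What remains is that N lies in the nilradical: x ^+ n is a product of n elements of N. *)
apply: unique_lifting_of_red; try exact: unique_lifting_redp.
move=> x Nx; exists n.
by have := Nn (fun=> x) (fun=> Nx); rewrite prodr_const card_ord.
Qed.
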